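(* Let $n\ge 4$, let $L/F$ be a Galois extension of fields with Galois group $\Gamma$, fix a representation (continuous homomorphism) $$\rho:\Gamma\to\mathfrak{S}_n,$$ and let ${}^{\rho}\overline{\mathcal M}_{0,n}$ denote the corresponding twist of $\overline{\mathcal M}_{0,n}$ defined over $F$. (a) If $\rho$ factors through an $\mathfrak{S}_{n-1}\subset\mathfrak{S}_n$ (the stabilizer of one of the marked points), then ${}^{\rho}\overline{\mathcal M}_{0,n}$ is rational over $F$. (b) If $n$ is odd, then $\mathbb{P}^1\times{}^{\rho}\overline{\mathcal M}_{0,n}$ is rational over $F$. The same holds if $\rho$ leaves an odd cycle invariant (i.e., the image of $\rho$ leaves invariant a subset of odd cardinality of $\{1,\dots,n\}$).
   Context: $\overline{\mathcal M}_{0,n}$ is the moduli space of stable $n$-pointed curves of genus zero; $\mathfrak{S}_n$ acts on it by permuting the marked points. The twist ${}^{\rho}\overline{\mathcal M}_{0,n}$ is the $F$-variety obtained from $\overline{\mathcal M}_{0,n}$ over $L$ by Galois descent, twisting the standard $\Gamma$-action by $\rho$ (so over $F$ the marked points are permuted by Galois via $\rho$). The field $F$ is arbitrary (possibly finite). *)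

(* Defs.v *)
(* An integral separated scheme of finite type over a field k is represented,
   after Chevalley and Nagata, by its function field K (here a subfield of an
   ambient field) together with the set of the local rings of its points, all of
   them subrings of K. *)

From HB Require Import structures.
From mathcomp Require Import all_boot all_order all_algebra all_fingroup.
From mathcomp Require Import all_field.
From mathcomp Require Import fraction.
From mathcomp.multinomials Require Import mpoly.

Set Implicit Arguments.
Unset Strict Implicit.
Unset Printing Implicit Defensive.

Import GRing.Theory.
Local Open Scope ring_scope.

Notation "x %:F" := (@FracField.tofrac _ x) : ring_scope.

(* Possibly infinite: every element of L is a root of an irreducible separable
   polynomial over F that splits in L (algebraic, separable and normal). *)
Definition galois_extension (F L : fieldType) (iota : {rmorphism F -> L}) :=
  forall x : L, exists p : {poly F},
    [/\ irreducible_poly p, separable_poly p, root (map_poly iota p) x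
      & exists s : seq L, map_poly iota p %= \prod_(a <- s) ('X - a%:P)].

Record Gal (F L : fieldType) (iota : {rmorphism F -> L}) := MkGal {
  gal_fun :> {rmorphism L -> L};
  gal_bij : bijective gal_fun;
  gal_fix : forall a : F, gal_fun (iota a) = iota a
}.

(* The law of Gal is composition of automorphisms, and permutations act on the
   left.  MathComp multiplies permutations in the opposite order, so the
   condition is spelled out on points. *)
Definition gal_hom (F L : fieldType) (iota : {rmorphism F -> L}) (n : nat)
    (rho : Gal iota -> 'S_n) :=
  forall g h gh : Gal iota, (forall x : L, gh x = g (h x)) ->
  forall i : 'I_n, rho gh i = rho g (rho h i).

(* Continuity for the Krull topology on the source and the discrete topology on
   the target. *)
Definition gal_continuous (F L : fieldType) (iota : {rmorphism F -> L})
    (n : nat) (rho : Gal iota -> 'S_n) :=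
  forall g : Gal iota, exists s : seq L,
  forall h : Gal iota, {in s, h =1 g} -> rho h = rho g.

Record variety (k : fieldType) := Variety {
  ambient : fieldType;
  scalar : {rmorphism k -> ambient};
  funfield : ambient -> Prop;
  stalk : (ambient -> Prop) -> Prop
}.

Section Charts.
Variables (k K : fieldType) (c : {rmorphism k -> K}).

(* k[S]; opposites come from the constant -1 *)
Inductive gen_alg (S : K -> Prop) : K -> Prop :=
| gen_const a : gen_alg S (c a)
| gen_in x of S x : gen_alg S x
| gen_add x y of gen_alg S x & gen_alg S y : gen_alg S (x + y)
| gen_mul x y of gen_alg S x & gen_alg S y : gen_alg S (x * y).

Definition frac_of (A : K -> Prop) (z : K) :=
  exists a b : K, [/\ A a, A b, b != 0 & z = a / b].

Definition prime_ideal (A P : K -> Prop) :=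
  [/\ forall x, P x -> A x,
      P 0 /\ ~ P 1,
      forall x y, P x -> P y -> P (x + y),
      forall a x, A a -> P x -> P (a * x)
    & forall a b, A a -> A b -> P (a * b) -> P a \/ P b].

Definition localization (A P : K -> Prop) (z : K) :=
  exists a b : K, [/\ A a, A b, ~ P b & z = a / b].

(* The integral scheme glued from the spectra of the domains A i, all having the
   same fraction field. *)
Definition glued (I : Type) (A : I -> K -> Prop) : variety k :=
  {| ambient := K;
     scalar := c;
     funfield := fun z => exists i : I, frac_of (A i) z;
     stalk := fun O => exists (i : I) (P : K -> Prop),
       prime_ideal (A i) P /\ forall z, O z <-> localization (A i) P z |}.

End Charts.

Definition frac_mpolyC (n : nat) (k : fieldType) :
  {rmorphism k -> {fraction {mpoly k[n]}}} :=
  (@FracField.tofrac {mpoly k[n]} \o @mpolyC n k).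

Definition frac_polyC (K : fieldType) : {rmorphism K -> {fraction {poly K}}} :=
  (@FracField.tofrac {poly K} \o @polyC K).

Definition projective_space (k : fieldType) (d : nat) : variety k :=
  glued (frac_mpolyC d.+1 k) (fun i : 'I_d.+1 =>
    gen_alg (frac_mpolyC d.+1 k)
      (fun z => exists j : 'I_d.+1, z = ('X_j)%:F / ('X_i)%:F)).

(* P^1 * X is covered by the spectra of O[t] and O[1/t], for O a local ring
   of X. *)
Definition P1_times (k : fieldType) (X : variety k) : variety k :=
  let c : {rmorphism k -> {fraction {poly (ambient X)}}} :=
    (frac_polyC (ambient X) \o @scalar k X) in
  glued c (fun Ob : {O : ambient X -> Prop | stalk O} * bool =>
    gen_alg c (fun z =>
      (exists2 a, sval Ob.1 a & z = frac_polyC (ambient X) a)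
      \/ z = if Ob.2 then 'X%:F else ('X%:F)^-1)).

(* Birational equivalence as a k-isomorphism of function fields; values of phi
   outside the function field of X are irrelevant. *)
Definition birational (k : fieldType) (X Y : variety k) :=
  exists phi : ambient X -> ambient Y,
  [/\ forall a : k, phi (scalar X a) = scalar Y a,
      forall x y, funfield x -> funfield y -> phi (x + y) = phi x + phi y,
      forall x y, funfield x -> funfield y -> phi (x * y) = phi x * phi y,
      forall x y, funfield x -> funfield y -> phi x = phi y -> x = y
    & (forall x, funfield x -> funfield (phi x)) /\
      (forall y, funfield y -> exists2 x, funfield x & phi x = y)].

Definition rational (k : fieldType) (X : variety k) :=
  exists d : nat, birational (projective_space k d) X.

(* Galois descent along F -> L: the quotient of the L-variety X by a semilinear
   action tau of the Galois group. *)
Definition descent (F L : fieldType) (iota : {rmorphism F -> L})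
    (X : variety L) (tau : Gal iota -> ambient X -> ambient X) : variety F :=
  {| ambient := ambient X;
     scalar := (@scalar L X \o iota);
     funfield := fun z => funfield z /\ forall g, tau g z = z;
     stalk := fun O => exists2 O' : ambient X -> Prop, stalk O' &
       forall z, O z <-> O' z /\ forall g, tau g z = z |}.

Section Mbar.
Variables (L : fieldType) (n : nat).

(* x_0, ..., x_(n-1) are the affine coordinates of n generic points of P^1. *)
Definition pt (i : 'I_n) : {fraction {mpoly L[n]}} := ('X_i)%:F.

Definition cross_ratio (i j k l : 'I_n) : {fraction {mpoly L[n]}} :=
  ((pt i - pt k) * (pt j - pt l)) / ((pt i - pt l) * (pt j - pt k)).

(* For each ordered quadruple of distinct marked points, forgetting the other
   points is a morphism to M_{0,4}-bar = P^1, the cross-ratio.  By a theorem of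
   Gerritzen, Herrlich and van der Put (valid over any base) the product of
   these morphisms is a closed immersion of M_{0,n}-bar; its image is the
   closure of M_{0,n}, the space of n distinct points of P^1 up to PGL_2.  On
   each product of standard affine lines of the P^1's, given by e, the
   coordinate ring of that closure is generated by the cross-ratios or their
   inverses. *)
Definition Mbar : variety L :=
  glued (frac_mpolyC n L) (fun e : 'I_n -> 'I_n -> 'I_n -> 'I_n -> bool =>
    gen_alg (frac_mpolyC n L) (fun z => exists i j k l : 'I_n,
      uniq [:: i; j; k; l] /\
      z = if e i j k l then cross_ratio i j k l else (cross_ratio i j k l)^-1)).

End Mbar.

Definition frac_map (R S : idomainType) (f : R -> S) (z : {fraction R}) :
    {fraction S} :=
  let r := generic_quotient.repr z in (f (frac r).1)%:F / (f (frac r).2)%:F.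

Lemma frac_numden (R : idomainType) (z : {fraction R}) :
  let r := generic_quotient.repr z in z = (frac r).1%:F / (frac r).2%:F.
Proof.
move=> /=; rewrite -[LHS]generic_quotient.reprK.
case: (generic_quotient.repr z) => -[a b] /= b0.
rewrite /GRing.inv /= /GRing.mul /=; unlock FracField.tofrac.
rewrite -[FracField.inv _]FracField.pi_inv -[RHS]FracField.pi_mul.
apply/generic_quotient.eqmodP; rewrite /= FracField.equivfE.
rewrite /FracField.invf /FracField.mulf.
rewrite !numden_Ratio ?oner_neq0 ?mulf_neq0 ?oner_neq0 //.
by rewrite ?mulr1 ?mul1r mulrC.
Qed.

Lemma frac_map_div (R S : idomainType) (f : {rmorphism R -> S}) (a b : R) :
  injective f -> b != 0 ->
  frac_map f (a%:F / b%:F) = (f a)%:F / (f b)%:F.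
Proof.
move=> f_inj b0; rewrite /frac_map.
have := frac_numden (a%:F / b%:F); set r := generic_quotient.repr _ => /= /eqP.
have r0 := denom_ratioP r.
have fI (c : R) : c != 0 -> (f c)%:F != 0 :> {fraction S}.
  by move=> c0; rewrite tofrac_eq0 -(rmorph0 f) (inj_eq f_inj).
rewrite eqr_div ?tofrac_eq0 // -!rmorphM tofrac_eq => /eqP E.
by apply/eqP; rewrite eq_sym eqr_div ?fI // -!rmorphM tofrac_eq E.
Qed.

Section Twist.
Variables (F L : fieldType) (iota : {rmorphism F -> L}) (n : nat).
Variable rho : Gal iota -> 'S_n.

Definition twist_poly (g : Gal iota) :
    {rmorphism {mpoly L[n]} -> {mpoly L[n]}} :=
  (msym (rho g) \o map_mpoly g).

(* The Galois group acts on coefficients and, through rho, on the variables: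
   f(x_0, ..., x_(n-1)) goes to (g f)(x_(rho g 0), ..., x_(rho g (n-1))).  An
   F-point of the quotient is then a configuration (p_i) over L with
   g p_i = p_(rho g i). *)
Definition twist_action (g : Gal iota) :
    ambient (Mbar L n) -> ambient (Mbar L n) :=
  frac_map (twist_poly g).

Lemma twist_poly_inj g : injective (twist_poly g).
Proof.
move=> p q /= /inj_msym E; apply/mpolyP => m; apply: (fmorph_inj g).
by rewrite -!mcoeff_map_mpoly E.
Qed.

Lemma twist_actionE g (p q : {mpoly L[n]}) : q != 0 ->
  twist_action g (p%:F / q%:F) = (twist_poly g p)%:F / (twist_poly g q)%:F.
Proof. exact/frac_map_div/twist_poly_inj. Qed.

Lemma twist_action_scalar g a :
  twist_action g (frac_mpolyC n L a) = frac_mpolyC n L (g a).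
Proof.
rewrite -[LHS]/(twist_action g (a%:MP%:F)) -[_%:F]divr1 -[1](rmorph1 (@FracField.tofrac _)).
rewrite twist_actionE ?oner_neq0 // !rmorph1 divr1 /= map_mpolyC.
by rewrite /msym mmapC.
Qed.

Lemma twist_action_pt g i : twist_action g (pt L i) = pt L (rho g i).
Proof.
rewrite -[pt L i]divr1 -[1](rmorph1 (@FracField.tofrac _)).
rewrite twist_actionE ?oner_neq0 // !rmorph1 divr1 /= map_mpolyX.
by rewrite /msym mmapX mmap1U.
Qed.

Definition twisted_Mbar : variety F := descent twist_action.

End Twist.

(* Main.v *)
(* The function field of M_{0,n}-bar is K0 = L(cross-ratios of y_1, ..., y_n).

   If a marked point is fixed, move it to infinity: the remaining points y_i of
   the affine line are taken up to affine maps, so that the function field is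
   generated by the quotients of elements of the vector space V spanned by the
   differences y_i - y_j, that is, the variety is a twist of P(V).  By Speiser's
   lemma V has a basis w_0, ..., w_d of Galois invariants, and the invariant
   field is F(w_1/w_0, ..., w_d/w_0).

   In general, the variety is the base of a conic bundle, the total space being
   the twist of M_{0,n+1}-bar with one more, fixed, marked point; by the first
   part this total space is rational.  In coordinates, the new point is infinity
   and the function field is K1 = L((y_i - y_j)/(y_k - y_l)).  An invariant
   subset S with 2m+1 elements is a divisor of odd degree on the conic, hence
   O(S) tensored with the m-th power of the canonical bundle has degree 1.  Its
   sections prod_k (y_{f(k,1)} - y_{f(k,0)}), for f a pairing of all points of
   S but one, are permuted by Galois, so that by Speiser's lemma again there are
   two independent invariant sections.  Their quotient u satisfies K1 = K0(u),
   and the invariant field of K1 is that of K0 with the transcendental u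
   adjoined. *)

Require Import Defs.
From HB Require Import structures.
From mathcomp Require Import all_boot all_algebra all_fingroup.
From mathcomp Require Import separable.
From mathcomp.classical Require Import boolp.
From mathcomp.classical Require classical_sets.
From mathcomp.multinomials Require Import mpoly.
From mathcomp Require Import ring zify.

Set Implicit Arguments.
Unset Strict Implicit.
Unset Printing Implicit Defensive.

Import GRing.Theory.
Local Open Scope ring_scope.

(** * Extension of automorphisms and the fixed field *)

(** All function fields are predicates on one ambient field [M], on which the Galois group acts. Two
    generalities shape the proof. L/F may be infinite. The fixed field is therefore found by
    extending automorphisms with Zorn's lemma, and continuity enters only through finite Galois sets
    T: the points, their pairs, the pairings. Equivariant functions from T to L separate points,
    hence span all functions; this is the form in which Speiser's lemma is used, for families of
    elements permuted by the group. F and L may be finite, so no general scalars can be chosen. The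
    infinitely many specializations that prove u transcendental over K0 are the substitutions y_i ->
    1/(y_i - z), z running through powers of one coordinate; being projective they fix K0, and they
    move u. Over L the conic has an explicit coordinate: with three points sent to infinity, 0 and
    1, all points get coordinates in K0, and K1 = K0(c), where -c is the image of the added point.
    The parameter u is a Moebius transform of c over K0. *)

Section FixedField.
Variables (F L : fieldType) (iota : {rmorphism F -> L}).

Definition diag (a : F) : L * L := (iota a, iota a).

Fact diag_is_zmod_morphism : zmod_morphism diag.
Proof. by move=> a b; rewrite /diag !rmorphB. Qed.
Fact diag_is_monoid_morphism : monoid_morphism diag.
Proof. by split=> [|a b]; rewrite /diag ?rmorph1 ?rmorphM. Qed.
HB.instance Definition _ :=
  GRing.isZmodMorphism.Build F (L * L)%type diag diag_is_zmod_morphism.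
HB.instance Definition _ :=
  GRing.isMonoidMorphism.Build F (L * L)%type diag diag_is_monoid_morphism.

(* The graph of an F-morphism to L from an F-subalgebra of L. *)
Definition partial_morphism (R : L * L -> Prop) :=
  [/\ forall a, R (diag a),
      forall u v, R u -> R v -> R (u + v),
      forall u v, R u -> R v -> R (u * v)
    & forall y, R (0, y) -> y = 0].

Lemma horner_fst (p : {poly L * L}) u : p.[u].1 = (map_poly fst p).[u.1].
Proof. by rewrite -horner_map. Qed.
Lemma horner_snd (p : {poly L * L}) u : p.[u].2 = (map_poly snd p).[u.2].
Proof. by rewrite -horner_map. Qed.
Lemma map_fst_diag p : map_poly fst (map_poly diag p) = map_poly iota p.
Proof. by rewrite -map_poly_comp. Qed.
Lemma map_snd_diag p : map_poly snd (map_poly diag p) = map_poly iota p.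
Proof. by rewrite -map_poly_comp. Qed.

Lemma irreducible_root_dvdp (p q : {poly F}) x :
  irreducible_poly p -> root (map_poly iota p) x ->
  root (map_poly iota q) x -> p %| q.
Proof.
move=> p_irr px qx; have [//|/negPf pNq] := boolP (p %| q).
have : coprimep p q by rewrite irreducible_poly_coprime // pNq.
rewrite -(coprimep_map iota) => /coprimep_root /(_ px).
by rewrite (rootP qx) eqxx.
Qed.

Section Closure.
Variable R : L * L -> Prop.
Hypothesis HR : partial_morphism R.
Let R_diag a : R (diag a). Proof. by case: HR. Qed.
Let R_add u v : R u -> R v -> R (u + v).
Proof. by case: HR => _ + _ _; apply. Qed.
Let R_mul u v : R u -> R v -> R (u * v).
Proof. by case: HR => _ _ + _; apply. Qed.
Let R_0 y : R (0, y) -> y = 0. Proof. by case: HR => _ _ _; apply. Qed.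
Let R_opp u : R u -> R (- u).
Proof. by move=> Ru; rewrite -mulN1r -(rmorphN1 diag); apply: R_mul. Qed.

Definition coefs_in (p : {poly L * L}) := forall i, R p`_i.

Lemma coefs_in_diag q : coefs_in (map_poly diag q).
Proof. by move=> i; rewrite coef_map; apply: R_diag. Qed.

Lemma coefs_in_add p q : coefs_in p -> coefs_in q -> coefs_in (p + q).
Proof. by move=> hp hq i; rewrite coefD; apply: R_add. Qed.

Lemma coefs_in_mul p q : coefs_in p -> coefs_in q -> coefs_in (p * q).
Proof.
move=> hp hq i; rewrite coefM; elim/big_rec: _ => [|j u _ hu].
  by rewrite -(rmorph0 diag).
by apply: R_add => //; apply: R_mul.
Qed.

Lemma coefs_inC u : R u -> coefs_in u%:P.
Proof.
by move=> Ru i; rewrite coefC; case: ifP => _ //; rewrite -(rmorph0 diag).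
Qed.

Lemma coefs_inX : coefs_in 'X.
Proof. by move=> i; rewrite coefX -(rmorph_nat diag). Qed.

Lemma horner_coefs_in p u : coefs_in p -> R u -> R p.[u].
Proof.
move=> hp Ru; rewrite horner_coef; elim/big_rec: _ => [|j v _ hv].
  by rewrite -(rmorph0 diag).
apply: R_add => //; apply: R_mul => //; elim: (j : nat) => [|k hk].
  by rewrite expr0 -(rmorph1 diag).
by rewrite exprS; apply: R_mul.
Qed.

Hypothesis algF : forall x : L,
  exists2 p : {poly F}, irreducible_poly p & root (map_poly iota p) x.

(** The irreducible polynomial p of the first component vanishes at both components of [u]. Writing
    p = qX + c with c nonzero gives the inverse -q(u)/c, which lies in [R]; the domain of a partial
    morphism is thus a field. *)
Lemma partial_morphism_unit u : R u -> u != 0 -> exists2 v, R v & v * u = 1.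
Proof.
case: u => a b Ru u0.
have a0 : a != 0.
  by apply: contraNneq u0 => a0; move: Ru; rewrite a0 => /R_0 ->.
have [p p_irr pa] := algF a.
have Rp : R (map_poly diag p).[(a, b)].
  by apply: horner_coefs_in => //; apply: coefs_in_diag.
have pu0 : (map_poly diag p).[(a, b)] = 0.
  move: Rp; rewrite [_.[_]]surjective_pairing horner_fst horner_snd.
  by rewrite map_fst_diag (rootP pa) => /R_0 ->.
have [[q c] /= p_eq] : exists qc : {poly F} * F, p = qc.1 * 'X + qc.2%:P.
  by elim/poly_ind: (p) => [|q c _]; [exists (0, 0) | exists (q, c)];
     rewrite ?mul0r ?addr0.
have c0 : c != 0.
  apply/eqP => c0; have Xp : 'X %| p by rewrite p_eq c0 addr0 dvdp_mulIr.
  have /andP[_ pX] : 'X %= p.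
    by case: p_irr => _ /(_ 'X); rewrite size_polyX; apply.
  have : root (map_poly iota 'X) a.
    rewrite -dvdp_XsubCl; apply: dvdp_trans (_ : _ %| map_poly iota p) _.
      by rewrite dvdp_XsubCl.
    by rewrite dvdp_map.
  by rewrite map_polyX rootX (negPf a0).
exists (diag (- c^-1) * (map_poly diag q).[(a, b)]).
  by apply: R_mul => //; apply: horner_coefs_in => //; apply: coefs_in_diag.
move: pu0; rewrite p_eq rmorphD rmorphM /=
  map_polyX map_polyC hornerD hornerM /=.
rewrite hornerX hornerC => /eqP; rewrite addr_eq0 => /eqP E.
by rewrite -mulrA E -rmorphN -rmorphM mulrNN mulVf ?rmorph1.
Qed.

(** Euclidean division over the subring [R] of L * L, a ring with zero divisors: the divisor is
    monic, and all coefficients stay in [R]. *)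
Lemma coefs_in_div p q : p \is monic -> coefs_in p -> coefs_in q ->
  exists d r, [/\ coefs_in d, coefs_in r, q = d * p + r & (size r < size p)%N].
Proof.
move=> p_mon hp; have [m] := ubnP (size q); elim: m q => // m IHm q.
rewrite ltnS => leqm hq; have [ltqp|lepq] := ltnP (size q) (size p).
  exists 0, q; split; rewrite ?mul0r ?add0r //.
  by rewrite -(rmorph0 (map_poly diag)); apply: coefs_in_diag.
have p0 : p != 0 by apply: monic_neq0.
pose t : {poly L * L} := (lead_coef q)%:P * 'X^(size q - size p).
have ht : coefs_in t.
  apply: coefs_in_mul; first exact/coefs_inC/hq.
  by move=> i; rewrite coefXn -(rmorph_nat diag).
have hq' : coefs_in (q - t * p).
  apply: coefs_in_add => // i; rewrite coefN; apply: R_opp; exact: coefs_in_mul.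
have q0 : (0 < size q)%N by apply: leq_trans lepq; rewrite size_poly_gt0.
have szq' : (size (q - t * p)%R < m)%N.
  apply: leq_trans leqm; rewrite -(prednK q0) ltnS; apply/leq_sizeP => j.
  have szp : (0 < size p)%N by rewrite size_poly_gt0.
  rewrite leq_eqVlt => /orP[/eqP <-|lt_j].
    rewrite coefB /t -mulrA coefCM coefXnM.
    rewrite ifF; last by lia.
    rewrite (_ : (_ - _)%N = (size p).-1); last by lia.
    by rewrite -/(lead_coef p) (monicP p_mon) mulr1 subrr.
  have ltqj : (size q <= j)%N by rewrite -(prednK q0).
  rewrite coefB /t -mulrA coefCM coefXnM nth_default // sub0r.
  case: ifP => _; first by rewrite mulr0 oppr0.
  rewrite [p`__]nth_default ?mulr0 ?oppr0 //.
  by apply: leq_trans (leq_sub2r _ ltqj); rewrite subKn.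
have [d [r [hd hr qE ltr]]] := IHm _ szq' hq'.
exists (t + d), r; split=> //; first exact: coefs_in_add.
by rewrite mulrDl -addrA -qE addrC subrK.
Qed.

(** The minimal polynomial P of z over the domain of [R] divides p. Its image under the morphism
    divides p as well, so it splits in L and has a root y. The new graph consists of the values Q(z,
    y), for Q with coefficients in [R]. *)
Lemma partial_morphism_extend z :
  (exists p : {poly F}, [/\ irreducible_poly p, root (map_poly iota p) z
     & exists s : seq L, map_poly iota p %= \prod_(a <- s) ('X - a%:P)]) ->
  exists R' : L * L -> Prop, exists y : L,
    [/\ partial_morphism R', forall u, R u -> R' u & R' (z, y)].
Proof.
case=> p [p_irr pz [s ps]].
pose vanish m := exists P : {poly L * L},
  [/\ coefs_in P, P \is monic, root (map_poly fst P) z & size P = m].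
have p0 : p != 0 by apply: irredp_neq0.
have [m [[P [hP P_mon Pz <-]] minP]] :
    exists m, vanish m /\ forall k, vanish k -> (m <= k)%N.
  have exm : exists m, `[< vanish m >].
    exists (size p); apply/asboolP; exists (map_poly diag
      ((lead_coef p)^-1 *: p)).
    have mon : (lead_coef p)^-1 *: p \is monic.
      by rewrite monicE lead_coefZ mulVf ?lead_coef_eq0.
    split; first exact: coefs_in_diag.
    - exact: monic_map.
    - by rewrite map_fst_diag map_polyZ rootZ // fmorph_eq0 invr_eq0
        lead_coef_eq0.
    rewrite size_map_poly_id0 ?size_scale ?invr_eq0 ?lead_coef_eq0 //.
    by rewrite (monicP mon) rmorph1 oner_neq0.
  exists (ex_minn exm); case: ex_minnP => m /asboolP vm minm; split=> // k vk.
  by apply: minm; apply/asboolP.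
(* A nonzero remainder could be made monic, its leading coefficient being invertible in [R], against
   the minimality of P. *)
have P_dvd Q : coefs_in Q -> root (map_poly fst Q) z -> exists D, Q = D * P.
  move=> hQ Qz; have [D [r [hD hr QE ltr]]] := coefs_in_div P_mon hP hQ.
  have rz : root (map_poly fst r) z.
    move/rootP: Qz; rewrite QE rmorphD rmorphM /= hornerD hornerM (rootP Pz).
    by rewrite mulr0 add0r => /rootP.
  have [r0|r0] := eqVneq r 0; first by exists D; rewrite QE r0 addr0.
  have lr0 : lead_coef r != 0 by rewrite lead_coef_eq0.
  have [v Rv vr] := partial_morphism_unit (hr _) lr0.
  have szr : size (v%:P * r) = size r.
    rewrite mul_polyC lreg_size //; apply: (can_inj (g := *%R (lead_coef r))).
    by move=> w; rewrite mulrA [_ * v]mulrC vr mul1r.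
  suff /minP : vanish (size r) by rewrite leqNgt ltr.
  exists (v%:P * r); split=> //.
  - by apply: coefs_in_mul => //; apply: coefs_inC.
  - by rewrite monicE /lead_coef szr mul_polyC coefZ vr.
  - by rewrite rmorphM /= rootM rz orbT.
have Pp : map_poly snd P %| map_poly iota p.
  have [|D pE] := P_dvd (map_poly diag p) (coefs_in_diag p).
    by rewrite map_fst_diag.
  by rewrite -map_snd_diag pE rmorphM /= dvdp_mulIr.
have szfst : size (map_poly fst P) = size P.
  by rewrite size_map_poly_id0 // (monicP P_mon) oner_neq0.
have szsnd : size (map_poly snd P) = size P.
  by rewrite size_map_poly_id0 // (monicP P_mon) oner_neq0.
have P1 : (1 < size P)%N.
  rewrite -szfst; apply: root_size_gt1 Pz.
  by rewrite -size_poly_gt0 szfst size_poly_gt0 monic_neq0.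
have [y Py] : exists y, root (map_poly snd P) y.
  move: Pp; rewrite (eqp_dvdr _ ps) => /dvdp_prod_XsubC[k Pk].
  move: (mask k s) Pk => [|y s'] Pk.
    by move: P1; rewrite -szsnd (eqp_size Pk) big_nil size_poly1.
  by exists y; rewrite (eqp_root Pk) big_cons rootM root_XsubC eqxx.
exists (fun u => exists2 Q, coefs_in Q & u = Q.[(z, y)]), y; split.
- split.
  + by move=> a; exists (diag a)%:P; [apply: coefs_inC | rewrite hornerC].
  + move=> _ _ [Q hQ ->] [Q' hQ' ->]; exists (Q + Q'); rewrite ?hornerD //.
    exact: coefs_in_add.
  + move=> _ _ [Q hQ ->] [Q' hQ' ->]; exists (Q * Q'); rewrite ?hornerM //.
    exact: coefs_in_mul.
  move=> y' [Q hQ QE]; have [|D QD] := P_dvd _ hQ.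
    by apply/rootP; rewrite -(horner_fst Q (z, y)) -QE.
  have -> : y' = Q.[(z, y)].2 by rewrite -QE.
  rewrite horner_snd QD rmorphM /= hornerM.
  by rewrite (rootP Py) mulr0.
- by move=> u Ru; exists u%:P; [apply: coefs_inC | rewrite hornerC].
- by exists 'X; [apply: coefs_inX | rewrite hornerX].
Qed.
End Closure.

Hypothesis hL : galois_extension iota.

Let algF (x : L) : exists2 p : {poly F},
  irreducible_poly p & root (map_poly iota p) x.
Proof. by have [p [? ? ? ?]] := hL x; exists p. Qed.

(** A maximal partial morphism sending x to y is defined on all of L, since it could otherwise be
    extended by one more element. It is onto because it permutes the finitely many roots of each
    irreducible polynomial over F. *)
Lemma conjugate_gal (p : {poly F}) x y : irreducible_poly p ->
  root (map_poly iota p) x -> root (map_poly iota p) y ->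
  exists g : Gal iota, g x = y.
Proof.
move=> p_irr px py.
pose good A := partial_morphism A /\ A (x, y).
have [A [PA maxA]] : exists A, (A = classical_sets.set0 \/ good A) /\ forall B,
  classical_sets.proper A B -> ~ (B = classical_sets.set0 \/ good B).
  apply: classical_sets.Zorn_bigcup => Ch hCh tot.
  have [[A ChA gA]|none] := pselect (exists2 A, Ch A & good A); last first.
    left; apply/classical_sets.seteqP; split=> // u [A ChA Au].
    have [A0|gA] := hCh A ChA; first by rewrite A0 in Au.
    by case: none; exists A.
  right; have gCh B u : Ch B -> B u -> good B.
    by move=> /hCh[->|//] /=.
  have tot2 u v B C : Ch B -> B u -> Ch C -> C v ->
      exists D, [/\ Ch D, D u & D v].
    move=> ChB Bu ChC Cv; have [BC|CB] := tot B C ChB ChC.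
      by exists C; split=> //; apply: BC.
    by exists B; split=> //; apply: CB.
  case: gA => [[A1 A2 A3 A4] Axy]; split; last by exists A.
  split.
  - by move=> a; exists A.
  - move=> u v [B ChB Bu] [C ChC Cv]; have [D [ChD Du Dv]] :=
      tot2 u v B C ChB Bu ChC Cv.
    by exists D => //; have [[_ + _ _] _] := gCh D u ChD Du; apply.
  - move=> u v [B ChB Bu] [C ChC Cv]; have [D [ChD Du Dv]] :=
      tot2 u v B C ChB Bu ChC Cv.
    by exists D => //; have [[_ _ + _] _] := gCh D u ChD Du; apply.
  - move=> w [B ChB Bw]; have [[_ _ _ +] _] := gCh B _ ChB Bw; exact.
have gA : good A.
  case: PA => // A0; exfalso.
  (* The empty graph is not maximal: it lies in the graph of F[x] -> F[y], well defined because p is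
     irreducible. *)
  pose B u := exists q : {poly F}, u =
    ((map_poly iota q).[x], (map_poly iota q).[y]).
  have gB : good B.
    split; last by exists 'X; rewrite map_polyX !hornerX.
    split.
    - by move=> a; exists a%:P; rewrite map_polyC !hornerC.
    - by move=> _ _ [q ->] [q' ->]; exists (q + q'); rewrite rmorphD !hornerD.
    - by move=> _ _ [q ->] [q' ->]; exists (q * q'); rewrite rmorphM !hornerM.
    move=> w [q [/esym/rootP qx ->]].
    have := irreducible_root_dvdp p_irr px qx; rewrite -(dvdp_map iota) => pq.
    by apply/rootP; rewrite -dvdp_XsubCl; apply: dvdp_trans pq;
      rewrite dvdp_XsubCl.
  apply: (maxA B); last by right.
  rewrite A0; split=> // /(_ (x, y)); apply; exact: gB.2.
have [hA Axy] := gA.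
have domA z : exists y, A (z, y).
  have [|A' [y' [hA' AA' A'zy]]] := partial_morphism_extend hA algF (z := z).
    by have [q [? _ ? ?]] := hL z; exists q.
  exists y'; apply: contrapT => NAzy; apply: (maxA A'); last first.
    by right; split=> //; apply: AA'.
  by split=> [u Au|sub]; [apply: AA' | apply: NAzy; apply: sub].
have [A1 A2 A3 A4] := hA.
have funA z y1 y2 : A (z, y1) -> A (z, y2) -> y1 = y2.
  move=> h1 h2; apply/eqP; rewrite -subr_eq0; apply/eqP/A4.
  have -> : (0, y1 - y2) = (z, y1) + diag (-1) * (z, y2).
    by apply/eqP; rewrite xpair_eqE /= rmorphN1 !mulN1r subrr !eqxx.
  by apply: (A2) => //; apply: A3.
pose f z := sval (cid (domA z)).
have fA z : A (z, f z) by rewrite /f; case: cid.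
have fE z w : A (z, w) -> f z = w by apply: funA.
have f_zmod : zmod_morphism f.
  move=> a b; apply: fE.
  have -> : (a - b, f a - f b) = (a, f a) + diag (-1) * (b, f b).
    by apply/eqP; rewrite xpair_eqE /= rmorphN1 !mulN1r !eqxx.
  by apply: (A2) => //; apply: A3.
have f_mon : monoid_morphism f.
  split=> [|a b]; first by apply: fE; rewrite -(rmorph1 iota); apply: A1.
  by apply: fE; apply: (A3 (a, f a) (b, f b)).
pose fz := GRing.isZmodMorphism.Build _ _ f f_zmod.
pose fm := GRing.isMonoidMorphism.Build _ _ f f_mon.
pose fM : {rmorphism L -> L} := HB.pack f fz fm.
have f_fix a : fM (iota a) = iota a by apply: fE; apply: A1.
suff f_bij : bijective fM by exists (MkGal f_bij f_fix); apply: fE.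
have f_surj w : exists z, fM z = w.
  have [q [q_irr _ qw [s qs]]] := hL w.
  have memr v : (v \in undup s) = root (map_poly iota q) v.
    by rewrite mem_undup (eqp_root qs) root_prod_XsubC.
  have fq v : root (map_poly iota q) v -> root (map_poly iota q) (fM v).
    move=> /rootP qv; apply/rootP.
    have -> : map_poly iota q = map_poly fM (map_poly iota q).
      by rewrite -map_poly_comp; apply: eq_map_poly => a; apply/esym/f_fix.
    by rewrite horner_map qv rmorph0.
  have uim : uniq [seq fM v | v <- undup s].
    by rewrite map_inj_uniq ?undup_uniq //; apply: fmorph_inj.
  have sub : {subset [seq fM v | v <- undup s] <= undup s}.
    by move=> _ /mapP[v vs ->]; rewrite memr fq // -memr.
  have [_ eqs] := uniq_min_size uim sub (eq_leq (esym (size_map _ _))).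
  by move: (eqs w); rewrite memr qw => /mapP[v _ ->]; exists v.
exists (fun w => sval (cid (f_surj w))) => w; last by case: cid.
by apply: (fmorph_inj fM); case: cid.
Qed.

(** The roots of the irreducible polynomial of x are all conjugate to x, hence equal to x, and they
    are distinct by separability; the degree is therefore 1. *)
Lemma gal_fixed x : (forall g : Gal iota, g x = x) -> exists a, x = iota a.
Proof.
move=> fx; have [p [p_irr p_sep px [s ps]]] := hL x.
have p0 := irredp_neq0 p_irr.
have szs : size s = (size p).-1.
  by have := eqp_size ps; rewrite size_prod_XsubC size_map_poly => ->.
have us : uniq s.
  by rewrite -separable_prod_XsubC -(eqp_separable ps) separable_map.
have allx y : y \in s -> y = x.
  rewrite -root_prod_XsubC -(eqp_root ps) => py.
  by have [g <-] := conjugate_gal p_irr px py; rewrite fx.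
have szp : size p = 2%N.
  have szp : (1 < size p)%N.
    by have := root_size_gt1 _ px; rewrite map_poly_eq0 size_map_poly; apply.
  apply/eqP; rewrite eqn_leq szp andbT; move: szs; case: (size p) => // k /= <-.
  rewrite ltnS -(size_nseq 1 x); apply: uniq_leq_size => // y /allx ->.
  by rewrite mem_seq1.
have p1 : p`_1 != 0 by have := lead_coef_eq0 p; rewrite /lead_coef szp /= => ->.
exists (- p`_0 / p`_1); move/rootP: px; rewrite horner_coef size_map_poly szp.
rewrite !big_ord_recl big_ord0 /= !coef_map expr0 expr1 mulr1 addr0 /bump /=
  addn0.
move/eqP; rewrite addrC addr_eq0 fmorph_div rmorphN => /eqP <-.
by rewrite mulrAC divff ?mul1r // fmorph_eq0.
Qed.

End FixedField.

(** * Equivariant functions on finite Galois sets *)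

Section GaloisSets.
Variables (F L : fieldType) (iota : {rmorphism F -> L}).
Hypothesis hL : galois_extension iota.
Local Notation Gal := (Gal iota).

Lemma gal_one : exists e : Gal, forall x, e x = x.
Proof.
have b : bijective (idfun : {rmorphism L -> L}) by exists id.
by exists (@MkGal _ _ iota idfun b (fun=> erefl)).
Qed.

Lemma gal_mul (g h : Gal) : exists gh : Gal, forall x, gh x = g (h x).
Proof.
have b : bijective (g \o h : {rmorphism L -> L}).
  exact: bij_comp (gal_bij g) (gal_bij h).
have f a : (g \o h : {rmorphism L -> L}) (iota a) = iota a.
  by rewrite /= !gal_fix.
by exists (MkGal b f).
Qed.

Lemma gal_inv (g : Gal) :
  exists h : Gal, (forall x, h (g x) = x) /\ (forall x, g (h x) = x).
Proof.
have [f gK fK] := gal_bij g.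
have f_zmod : zmod_morphism f.
  by move=> a b; rewrite -[a in LHS]fK -[b in LHS]fK -rmorphB gK.
have f_mon : monoid_morphism f.
  split=> [|a b]; first by rewrite -[1 in LHS](rmorph1 g) gK.
  by rewrite -[a in LHS]fK -[b in LHS]fK -rmorphM gK.
pose fz := GRing.isZmodMorphism.Build _ _ f f_zmod.
pose fm := GRing.isMonoidMorphism.Build _ _ f f_mon.
pose fM : {rmorphism L -> L} := HB.pack f fz fm.
have b : bijective fM by exists g.
have ff a : fM (iota a) = iota a by rewrite /= -[iota a in LHS](gal_fix g) gK.
by exists (MkGal b ff).
Qed.

Lemma gal_orbit_finite (x : L) : exists r : seq L, forall g : Gal, g x \in r.
Proof.
have [p [_ _ px [s ps]]] := hL x; exists s => g.
rewrite -root_prod_XsubC -(eqp_root ps).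
have -> : map_poly iota p = map_poly g (map_poly iota p).
  by rewrite -map_poly_comp; apply: eq_map_poly => a; rewrite /= gal_fix.
by apply/rootP; rewrite horner_map (rootP px) rmorph0.
Qed.

Lemma gal_poly_orbit_finite (p : {poly L}) :
  exists r : seq {poly L}, forall g : Gal, map_poly g p \in r.
Proof.
elim/poly_ind: p => [|p c [r hr]].
  by exists [:: 0] => g; rewrite rmorph0 inE.
have [r' hr'] := gal_orbit_finite c.
exists [seq q * 'X + d%:P | q <- r, d <- r'] => g.
rewrite rmorphD rmorphM /= map_polyX map_polyC /=.
by apply/allpairsP; exists (map_poly g p, g c); rewrite hr hr'.
Qed.

Definition gal_action (T : Type) (act : Gal -> T -> T) :=
  forall g h gh : Gal, (forall x, gh x = g (h x)) ->
  forall t, act gh t = act g (act h t).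

Definition continuous_action (T : Type) (act : Gal -> T -> T) :=
  exists s : seq L, forall g : Gal, {in s, forall x, g x = x} ->
  forall t, act g t = t.

Section Action.
Variables (T : Type) (act : Gal -> T -> T).
Hypotheses (act_mul : gal_action act) (act_cont : continuous_action act).

Lemma act_one (e : Gal) : (forall x, e x = x) -> forall t, act e t = t.
Proof. by move=> e1 t; have [s hs] := act_cont; apply: hs => x _. Qed.

Lemma act_cancel (g h : Gal) : (forall x, h (g x) = x) ->
  forall t, act h (act g t) = t.
Proof.
move=> hg t; have [e e1] := gal_one; rewrite -(act_mul (gh := e)) ?act_one //.
by move=> x; rewrite e1 hg.
Qed.

Definition equivariant (v : T -> L) := forall (g : Gal) t, g (v t) =
  v (act g t).

(** On an orbit an equivariant function is determined by its value at one point, which may be any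
    element fixed by the stabilizer; elsewhere it is set to 0. *)
Lemma equivariant_extend t theta :
  (forall g : Gal, act g t = t -> g theta = theta) ->
  exists v, [/\ equivariant v, v t = theta
    & forall t', ~ (exists g, act g t = t') -> v t' = 0].
Proof.
move=> th_fix.
pose v t' := if pselect (exists g, act g t = t') is left h
  then sval (cid h) theta else 0.
have v_act k : v (act k t) = k theta.
  rewrite /v; case: pselect => [h|]; last by case; exists k.
  case: cid => /= k' k'k; have [j [jk' k'j]] := gal_inv k'.
  have [m mE] := gal_mul j k.
  have -> : k theta = k' (m theta) by rewrite mE k'j.
  by rewrite (th_fix m) // (act_mul mE) -k'k (act_cancel jk').
have v_out t' : ~ (exists g, act g t = t') -> v t' = 0.
  by rewrite /v; case: pselect.
exists v; split=> //; last first.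
  by have [e e1] := gal_one; rewrite -[t in LHS](act_one e1) v_act e1.
move=> g t'; have [[k <-]|Nt'] := pselect (exists k, act k t = t').
  by have [m mE] := gal_mul g k; rewrite -(act_mul mE) !v_act mE.
rewrite !v_out ?rmorph0 // => -[k kE]; apply: Nt'.
have [j [jg gj]] := gal_inv g; have [m mE] := gal_mul j k.
by exists m; rewrite (act_mul mE) kE act_cancel.
Qed.

(* The product of the 'X - B, for B in the orbit of a polynomial p0 under the
   stabilizer H of t, has coefficients fixed by H; an element of Gal fixing all
   of them sends p0 into its H-orbit.  The coefficients of p0 are chosen so that
   only elements of H do this. *)
Lemma stabilizer_fixed t (h : Gal) : act h t <> t ->
  exists2 theta, (forall g : Gal, act g t = t -> g theta = theta)
    & h theta != theta.
Proof.
move=> ht; apply: contrapT => Nex.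
have fixh theta : (forall g : Gal, act g t = t -> g theta = theta) ->
    h theta = theta.
  by move=> fx; apply: contrapT => /eqP N; apply: Nex; exists theta.
have [s hs] := act_cont; pose p0 := Poly s.
have fix_p0 (k : Gal) : map_poly k p0 = p0 -> act k t = t.
  move=> kp0; apply: hs => x /(nthP 0)[i _ <-].
  by rewrite -coef_Poly -[RHS](congr1 (fun p : {poly L} => p`_i) kp0) coef_map.
have [r hr] := gal_poly_orbit_finite p0.
pose inO B := `[< exists2 g : Gal, act g t = t & B = map_poly g p0 >].
pose O := undup [seq B <- r | inO B].
have memO B : (B \in O) = inO B.
  by rewrite mem_undup mem_filter; apply: andb_idr => /asboolP[g _ ->];
    apply: hr.
have O_stable (g : Gal) : act g t = t -> perm_eq [seq map_poly g B | B <- O] O.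
  move=> gt; have sub : {subset [seq map_poly g B | B <- O] <= O}.
    move=> _ /mapP[B + ->]; rewrite !memO => /asboolP[k kt ->]; apply/asboolP.
    have [m mE] := gal_mul g k; exists m; first by rewrite (act_mul mE) kt.
    by rewrite -map_poly_comp; apply: eq_map_poly => x; rewrite mE.
  have uim : uniq [seq map_poly g B | B <- O].
    by rewrite map_inj_uniq ?undup_uniq //; apply/map_poly_inj.
  apply: uniq_perm; rewrite ?undup_uniq //.
  by have [] := uniq_min_size uim sub (eq_leq (esym (size_map _ _))).
pose Pi := \prod_(B <- O) ('X - B%:P).
have map_Pi (k : Gal) :
    map_poly (map_poly k) Pi = \prod_(B <- [seq map_poly k B | B <- O])
      ('X - B%:P).
  rewrite big_map rmorph_prod; apply: eq_bigr => B _.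
  by rewrite rmorphB /= map_polyX map_polyC.
have h_Pi : map_poly (map_poly h) Pi = Pi.
  apply/polyP => i; rewrite coef_map; apply/polyP => j; rewrite coef_map /=.
  apply: fixh => g gt.
  have g_Pi : map_poly (map_poly g) Pi = Pi.
    by rewrite map_Pi; apply: perm_big; apply: O_stable.
  by rewrite -[in RHS]g_Pi !coef_map.
have [e e1] := gal_one.
have p0O : p0 \in O.
  rewrite memO; apply/asboolP; exists e; first exact: act_one.
  by rewrite map_poly_id // => x _; rewrite e1.
have : map_poly h p0 \in O.
  rewrite -(root_prod_XsubC O) -/Pi -h_Pi map_Pi root_prod_XsubC.
  exact: map_f.
rewrite memO => /asboolP[g gt hg]; apply: ht.
have [j [jg gj]] := gal_inv g; have [m mE] := gal_mul j h.
rewrite -[RHS]gt -[LHS](act_cancel gj); congr act.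
rewrite -(act_mul mE); apply: fix_p0.
rewrite (eq_map_poly mE) (map_poly_comp j h) hg -map_poly_comp map_poly_id //.
by move=> x _ /=; rewrite jg.
Qed.

(** If t' = h t, the value at t has to be fixed by the stabilizer of t and moved by h. In different
    orbits the indicator function of the orbit of t serves. *)
Lemma equivariant_separate t t' : t <> t' ->
  exists2 v, equivariant v & v t != v t'.
Proof.
move=> tt'; have [[h hE]|N] := pselect (exists h, act h t = t').
  have [|theta th_fix th_h] := stabilizer_fixed (t := t) (h := h).
    by rewrite hE => E; apply: tt'.
  have [v [v_eq v_t _]] := equivariant_extend th_fix.
  by exists v; rewrite // -hE -v_eq v_t eq_sym.
have [|v [v_eq v_t v_0]] := equivariant_extend (t := t) (theta := 1).
  by move=> g _; rewrite rmorph1.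
by exists v; rewrite // v_t v_0 // oner_neq0.
Qed.

Inductive equivariant_span : (T -> L) -> Prop :=
| Espan0 f of (forall t, f t = 0) : equivariant_span f
| EspanS a v f f' of equivariant v & equivariant_span f &
    (forall t, f' t = a * v t + f t) : equivariant_span f'.

Lemma equivariant_span_ext f f' :
  equivariant_span f -> f =1 f' -> equivariant_span f'.
Proof.
case=> [g g0 ff'|a v g g' v_eq hg g'E ff'].
  by apply: Espan0 => t; rewrite -ff'.
by apply: EspanS v_eq hg _ => t; rewrite -ff'.
Qed.

Lemma equivariant_span_add f f' : equivariant_span f -> equivariant_span f' ->
  equivariant_span (fun t => f t + f' t).
Proof.
move=> hf hf'; elim: hf => [g g0|a v g g' v_eq _ IH g'E].
  by apply: equivariant_span_ext hf' _ => t; rewrite g0 add0r.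
by apply: (EspanS (a := a) v_eq IH) => t; rewrite g'E addrA.
Qed.

Lemma equivariant_span_mulr f v a : equivariant_span f -> equivariant v ->
  equivariant_span (fun t => a * v t * f t).
Proof.
move=> hf v_eq; elim: hf => [g g0|b w g g' w_eq _ IH g'E].
  by apply: Espan0 => t; rewrite g0 mulr0.
have vw_eq : equivariant (fun t => v t * w t).
  by move=> h t; rewrite rmorphM v_eq w_eq.
apply: (EspanS (a := a * b) vw_eq IH) => t.
by rewrite g'E mulrDr; congr (_ + _); rewrite -!mulrA; congr (_ * _);
  rewrite mulrCA.
Qed.

Lemma equivariant_one : equivariant (fun=> 1).
Proof. by move=> g t; rewrite rmorph1. Qed.

(** Lagrange interpolation: each t' in [q] contributes the factor (v - v t') / (v t - v t'), for an
    equivariant v separating t from t'. The span absorbs such factors because products of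
    equivariant functions are equivariant. *)
Lemma equivariant_span_separate t (q : seq T) : List.Forall (fun t' => t <> t')
  q ->
  exists f, [/\ equivariant_span f, f t =
    1 & List.Forall (fun t' => f t' = 0) q].
Proof.
elim: q => [|t' q IHq] hq.
  exists (fun=> 1); split=> //.
  apply: (EspanS (a := 1) equivariant_one
    (Espan0 (f := fun=> 0) (fun=> erefl))).
  by move=> t'; rewrite mulr1 addr0.
inversion hq as [|? ? tt' hq']; subst.
have [f [hf f1 f0]] := IHq hq'; have [v v_eq v_tt'] := equivariant_separate tt'.
have d0 : v t - v t' != 0 by rewrite subr_eq0.
pose a := (v t - v t')^-1.
exists (fun s => a * v s * f s + (- a * v t') * 1 * f s); split.
- apply: equivariant_span_add; first exact: equivariant_span_mulr.
  exact: (equivariant_span_mulr (- a * v t') hf equivariant_one).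
- by rewrite f1 !mulr1 mulNr -mulrBr mulVf.
apply: List.Forall_cons; first by rewrite mulr1 mulNr mulNr addrN.
by apply: List.Forall_impl f0 => s s0; rewrite s0 !mulr0 addr0.
Qed.

End Action.

(** Equivariant functions thus span all functions from T to L: Speiser's lemma for permutation
    modules. *)
Lemma equivariant_span_delta (T : finType) (act : Gal -> T -> T) :
  gal_action act -> continuous_action act ->
  forall t, equivariant_span act (fun t' => (t' == t)%:R).
Proof.
move=> act_mul act_cont t.
have forall_neq q : t \notin q -> List.Forall (fun t' => t <> t') q.
  elim: q => [|t' q IHq] //; rewrite inE negb_or => /andP[/eqP tt' /IHq hq].
  exact: List.Forall_cons.
have [|f [hf f1 f0]] := equivariant_span_separate act_mul act_cont
  (forall_neq (enum (predC1 t)) _).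
  by rewrite mem_enum inE eqxx.
apply: equivariant_span_ext hf _ => t'; have [->//|t't] := eqVneq t' t.
have : t' \in enum (predC1 t) by rewrite mem_enum inE.
by elim: f0 => // s q s0 _ IH; rewrite inE => /orP[/eqP ->|].
Qed.

End GaloisSets.

(** * Descent of linear combinations *)

Section Subfields.
Variable M : fieldType.

Definition subfield (Q : M -> Prop) :=
  [/\ Q 1, forall x y, Q x -> Q y -> Q (x - y),
      forall x y, Q x -> Q y -> Q (x * y) & forall x, Q x -> Q x^-1].

Section Closure.
Variable Q : M -> Prop.
Hypothesis hQ : subfield Q.

Lemma subfield1 : Q 1. Proof. by case: hQ. Qed.
Lemma subfieldB x y : Q x -> Q y -> Q (x - y).
Proof. by case: hQ => _ + _ _; apply. Qed.
Lemma subfieldM x y : Q x -> Q y -> Q (x * y).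
Proof. by case: hQ => _ _ + _; apply. Qed.
Lemma subfieldV x : Q x -> Q x^-1. Proof. by case: hQ => _ _ _; apply. Qed.
Lemma subfield0 : Q 0.
Proof. by rewrite -(subrr 1); apply: subfieldB subfield1 subfield1. Qed.
Lemma subfieldN x : Q x -> Q (- x).
Proof. by rewrite -sub0r; apply: subfieldB subfield0. Qed.
Lemma subfieldD x y : Q x -> Q y -> Q (x + y).
Proof. by move=> hx hy; rewrite -[y]opprK; apply/subfieldB/subfieldN. Qed.
Lemma subfield_div x y : Q x -> Q y -> Q (x / y).
Proof. by move=> hx hy; apply/subfieldM/subfieldV. Qed.
Lemma subfieldX x n : Q x -> Q (x ^+ n).
Proof.
by move=> hx; elim: n => [|n IHn]; rewrite ?expr0 ?exprS;
  [apply: subfield1 | apply: subfieldM].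
Qed.
Lemma subfield_sum (I : Type) (r : seq I) (P : pred I) (f : I -> M) :
  (forall i, P i -> Q (f i)) -> Q (\sum_(i <- r | P i) f i).
Proof.
by move=> h; elim/big_rec: _ => [|i x Pi hx];
  [apply: subfield0 | apply: subfieldD; first exact: h].
Qed.
Lemma subfield_prod (I : Type) (r : seq I) (P : pred I) (f : I -> M) :
  (forall i, P i -> Q (f i)) -> Q (\prod_(i <- r | P i) f i).
Proof.
by move=> h; elim/big_rec: _ => [|i x Pi hx];
  [apply: subfield1 | apply: subfieldM; first exact: h].
Qed.
Lemma subfield_horner (p : {poly M}) x : (forall i, Q p`_i) -> Q x -> Q p.[x].
Proof.
move=> hp hx; rewrite horner_coef; apply: subfield_sum => i _.
by apply: subfieldM => //; apply: subfieldX.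
Qed.
Lemma subfield_coefC a : Q a -> forall i, Q (a%:P)`_i.
Proof.
by move=> ha i; rewrite coefC; case: ifP => _ //; apply: subfield0.
Qed.
Lemma subfield_coefX i : Q ('X : {poly M})`_i.
Proof.
by rewrite coefX; case: eqP => _; [apply: subfield1 | apply: subfield0].
Qed.
Lemma subfield_coefM (p q : {poly M}) :
  (forall i, Q p`_i) -> (forall i, Q q`_i) -> forall i, Q (p * q)`_i.
Proof.
by move=> hp hq i; rewrite coefM; apply: subfield_sum => j _; apply: subfieldM.
Qed.
End Closure.

Lemma subfield_fixed (G : Type) (tau : G -> {rmorphism M -> M}) (Q : M -> Prop)
  :
  subfield Q -> subfield (fun z => Q z /\ forall g, tau g z = z).
Proof.
move=> hQ; split.
- by split=> [|g]; [apply: subfield1 | rewrite rmorph1].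
- move=> x y [hx fx] [hy fy]; split=> [|g]; first exact: subfieldB.
  by rewrite rmorphB fx fy.
- move=> x y [hx fx] [hy fy]; split=> [|g]; first exact: subfieldM.
  by rewrite rmorphM fx fy.
- move=> x [hx fx]; split=> [|g]; first exact: subfieldV.
  by rewrite fmorphV fx.
Qed.

Variables (k : fieldType) (c : {rmorphism k -> M}).

Section FracGen.
Variable S : M -> Prop.
Local Notation A := (gen_alg c S).

Lemma gen_alg0 : A 0. Proof. by rewrite -(rmorph0 c); apply: gen_const. Qed.
Lemma gen_alg1 : A 1. Proof. by rewrite -(rmorph1 c); apply: gen_const. Qed.
Lemma gen_algN x : A x -> A (- x).
Proof.
by move=> hx; rewrite -mulN1r -(rmorphN1 c); apply: gen_mul;
  first exact: gen_const.
Qed.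

Lemma frac_of_sub x : A x -> frac_of A x.
Proof.
by move=> hx; exists x, 1; rewrite oner_neq0 divr1; split=> //; apply: gen_alg1.
Qed.

Lemma frac_of_subfield : subfield (frac_of A).
Proof.
split; first exact/frac_of_sub/gen_alg1.
- move=> _ _ [a [b [ha hb b0 ->]]] [a' [b' [ha' hb' b'0 ->]]].
  exists (a * b' - a' * b), (b * b'); split; rewrite ?mulf_neq0 //.
  + by apply: gen_add; [apply: gen_mul | apply: gen_algN; apply: gen_mul].
  + exact: gen_mul.
  by field; rewrite b0 b'0.
- move=> _ _ [a [b [ha hb b0 ->]]] [a' [b' [ha' hb' b'0 ->]]].
  exists (a * a'), (b * b'); split; rewrite ?mulf_neq0 //.
  + exact: gen_mul.
  + exact: gen_mul.
  by field; rewrite b0 b'0.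
move=> _ [a [b [ha hb b0 ->]]]; have [->|a0] := eqVneq a 0.
  by rewrite mul0r invr0; apply/frac_of_sub/gen_alg0.
by exists b, a; rewrite invf_div; split.
Qed.

Lemma frac_of_min (Q : M -> Prop) : subfield Q -> (forall a, Q (c a)) ->
  (forall x, S x -> Q x) -> forall z, frac_of A z -> Q z.
Proof.
move=> hQ Qc QS z [a [b [ha hb _ ->]]]; suff AQ x : A x -> Q x.
  by apply: subfield_div => //; apply: AQ.
elim=> // [y w _ hy _ hw|y w _ hy _ hw]; first exact: subfieldD.
exact: subfieldM.
Qed.
End FracGen.

Lemma eq_frac_of_gen (S S' : M -> Prop) :
  (forall x, S x -> frac_of (gen_alg c S') x) ->
  (forall x, S' x -> frac_of (gen_alg c S) x) ->
  forall z, frac_of (gen_alg c S) z <-> frac_of (gen_alg c S') z.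
Proof.
move=> h h' z; split; apply: frac_of_min => //; first
  [exact: frac_of_subfield | by move=> a; apply/frac_of_sub/gen_const].
Qed.

End Subfields.

Section Descent.
Variables (M : fieldType) (G : Type) (tau : G -> {rmorphism M -> M}).
Variable k : M -> Prop.
Hypotheses (hk : subfield k) (k_tau : forall g a, k a -> k (tau g a)).

Fixpoint comb (ms : seq M) (x : M) : Prop :=
  if ms is m :: ms' then
    exists a x', [/\ k a, comb ms' x' & x = a * m + x']
  else x = 0.

Lemma comb_add ms x y : comb ms x -> comb ms y -> comb ms (x + y).
Proof.
elim: ms x y => [|m ms IH] x y /=; first by move=> -> ->; rewrite addr0.
move=> [a [x' [ka hx ->]]] [b [y' [kb hy ->]]]; exists (a + b), (x' + y').
by split; [apply: subfieldD | apply: IH | rewrite mulrDl addrACA].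
Qed.

Lemma comb_scale ms a x : k a -> comb ms x -> comb ms (a * x).
Proof.
move=> ka; elim: ms x => [|m ms IH] x /=; first by move=> ->; rewrite mulr0.
move=> [b [x' [kb hx ->]]]; exists (a * b), (a * x').
by split; [apply: subfieldM | apply: IH | rewrite mulrDr mulrA].
Qed.

Lemma comb_opp ms x : comb ms x -> comb ms (- x).
Proof.
by move=> hx; rewrite -mulN1r; apply: comb_scale => //;
  exact: subfieldN (subfield1 hk).
Qed.

Lemma comb0 ms : comb ms 0.
Proof.
elim: ms => //= m ms IH; exists 0, 0; split=> //; first exact: subfield0.
by rewrite mul0r addr0.
Qed.

Lemma comb_mem ms m : m \in ms -> comb ms m.
Proof.
elim: ms => //= m' ms IH; rewrite inE => /orP[/eqP->|/IH hm].
  by exists 1, 0; rewrite mul1r addr0; split=> //;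
    [apply: subfield1 | apply: comb0].
by exists 0, m; rewrite mul0r add0r; split=> //; apply: subfield0.
Qed.

Lemma comb_min ms (W : M -> Prop) x : W 0 ->
  (forall a m y, k a -> m \in ms -> W y -> W (a * m + y)) -> comb ms x -> W x.
Proof.
move=> W0; elim: ms x => [|m ms IH] x /= hW; first by move=> ->.
move=> [a [x' [ka hx ->]]]; apply: (hW); rewrite ?inE ?eqxx //.
by apply: IH hx => b m' y kb hm'; apply: hW; rewrite // inE hm' orbT.
Qed.

Lemma comb_tau ms g x : {in ms, forall m, tau g m = m} ->
  comb ms x -> comb ms (tau g x).
Proof.
elim: ms x => [|m ms IH] x hms /=; first by move=> ->; rewrite rmorph0.
move=> [a [x' [ka hx ->]]]; exists (tau g a), (tau g x').
rewrite rmorphD rmorphM (hms m) ?inE ?eqxx //; split=> //; first exact: k_tau.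
by apply: IH => // m' hm'; apply: hms; rewrite inE hm' orbT.
Qed.

(** A module of invariants over the invariant part of [k]. In the applications it is a ring, F[S] or
    the polynomials in u with invariant coefficients. *)
Variable R0 : M -> Prop.
Hypotheses (R00 : R0 0) (R0D : forall x y, R0 x -> R0 y -> R0 (x + y))
  (R0Z : forall a m, k a -> (forall g, tau g a = a) -> R0 m -> R0 (a * m))
  (R0_tau : forall m g, R0 m -> tau g m = m).

(* If the first coefficient is moved by g, then subtracting from x its image
   under g eliminates the first term. *)
Lemma comb_fixed ms x : {in ms, forall m, R0 m} -> comb ms x ->
  (forall g, tau g x = x) -> R0 x.
Proof.
elim: ms x => [|m ms IH] x hms /=; first by move=> ->.
have hm : R0 m by apply: hms; rewrite inE eqxx.
have hms' : {in ms, forall m, R0 m} by move=> m' hm'; apply: hms;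
  rewrite inE hm' orbT.
move=> [a [x' [ka hx xE]]] fx.
have [fa|/existsNP[g /eqP ga]] := pselect (forall g, tau g a = a).
  rewrite xE; apply: R0D; first exact: R0Z.
  apply: IH => // g; have := fx g; rewrite xE rmorphD rmorphM fa (R0_tau g hm).
  by move/addrI.
have d0 : tau g a - a != 0 by rewrite subr_eq0.
have mE : m = - (tau g a - a)^-1 * (tau g x' - x').
  have /eqP := fx g; rewrite xE rmorphD rmorphM (R0_tau g hm) -subr_eq0 => /eqP
    E.
  apply: (mulfI d0); rewrite mulNr mulrN mulrA divff // mul1r.
  by apply/eqP; rewrite -subr_eq0 opprK -E; apply/eqP; ring.
apply: IH => //; rewrite xE mE mulrA; apply: comb_add => //; apply: comb_scale.
  exact: subfieldM ka (subfieldN hk (subfieldV hk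
    (subfieldB hk (k_tau _ ka) ka))).
apply: comb_add; last exact: comb_opp.
by apply: comb_tau => // m' /hms' /R0_tau.
Qed.

(** Induction on the length of the denominator, whose first coefficient is scaled to 1. If the
    denominator is then invariant, so is the numerator, and [comb_fixed] applies to both. Otherwise
    some g moves it; replacing a, b by g a - a, g b - b keeps the invariant quotient z and cancels
    the first term of b. *)
Lemma descent_frac ms ms' a b z : {in ms, forall m, R0 m} ->
  {in ms', forall m, R0 m} -> comb ms a -> comb ms' b -> b != 0 -> z * b = a ->
  (forall g, tau g z = z) -> exists a' b',
    [/\ R0 a', R0 b', b' != 0 & z = a' / b'].
Proof.
move=> hms + ha hb b0 zb fz.
elim: ms' a b ha hb b0 zb => [|m ms' IH] a b ha /= hb b0 zb hms'.
  by rewrite hb eqxx in b0.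
have hm : R0 m by apply: hms'; rewrite inE eqxx.
have {}hms' : {in ms', forall m, R0 m}.
  by move=> m' hm'; apply: hms'; rewrite inE hm' orbT.
case: hb => al [b' [kal hb bE]]; have [al0|al0] := eqVneq al 0.
  by apply: (IH a b) => //; rewrite bE al0 mul0r add0r.
have ka' : k al^-1 by apply: subfieldV.
have hb1 : comb (m :: ms') (al^-1 * b).
  exists 1, (al^-1 * b'); split; [exact: subfield1 | exact: comb_scale |].
  by rewrite bE mulrDr mulrA mulVf // mul1r.
have ha1 := comb_scale ka' ha.
have zb1 : z * (al^-1 * b) = al^-1 * a by rewrite mulrCA zb.
have b10 : al^-1 * b != 0 by rewrite mulf_neq0 ?invr_eq0.
have [fb|/existsNP[g /eqP gb]] := pselect
  (forall g, tau g (al^-1 * b) = al^-1 * b).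
  exists (al^-1 * a), (al^-1 * b); split=> //.
  - by apply: comb_fixed hms ha1 _ => g; rewrite -zb1 rmorphM fz fb.
  - apply: comb_fixed hb1 fb => m'; rewrite inE => /orP[/eqP->//|]; exact: hms'.
  by rewrite -zb1 mulfK.
apply: (IH (tau g (al^-1 * a) - al^-1 * a)
  (tau g (al^-1 * b) - al^-1 * b)) => //.
- apply: comb_add; last exact: comb_opp.
  by apply: comb_tau => // m' /hms /R0_tau.
- have -> : al^-1 * b = m + al^-1 * b' by rewrite bE mulrDr mulrA mulVf //
    mul1r.
  rewrite rmorphD (R0_tau g hm) opprD addrACA subrr add0r.
  have hb' := comb_scale ka' hb; apply: comb_add; last exact: comb_opp.
  by apply: comb_tau => // m' /hms' /R0_tau.
- by rewrite subr_eq0.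
by rewrite mulrBr zb1 -[X in X * _](fz g) -rmorphM zb1.
Qed.

End Descent.

(** * Speiser's lemma for a permuted family *)

Section Speiser.
Variables (F L : fieldType) (iota : {rmorphism F -> L}).
Hypothesis hL : galois_extension iota.
Variables (M : fieldType) (c : {rmorphism L -> M}).
Variable tau : Gal iota -> {rmorphism M -> M}.
Hypothesis tau_c : forall g a, tau g (c a) = c (g a).

Definition scalars (z : M) := exists a, z = c a.

Lemma scalars_subfield : subfield scalars.
Proof.
split; first by exists 1; rewrite rmorph1.
- by move=> _ _ [a ->] [b ->]; exists (a - b); rewrite rmorphB.
- by move=> _ _ [a ->] [b ->]; exists (a * b); rewrite rmorphM.
by move=> _ [a ->]; exists a^-1; rewrite fmorphV.
Qed.

Lemma scalars_tau g z : scalars z -> scalars (tau g z).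
Proof. by move=> [a ->]; exists (g a); rewrite tau_c. Qed.

Variables (T : finType) (act : Gal iota -> T -> T).
Hypotheses (act_mul : gal_action act) (act_cont : continuous_action act).
Variable s : T -> M.
Hypothesis tau_s : forall g t, tau g (s t) = s (act g t).

Definition invariant_comb (m : M) :=
  (forall g, tau g m = m) /\ exists v, m = \sum_t c (v t) * s t.

Lemma equivariant_invariant v : equivariant act v ->
  invariant_comb (\sum_t c (v t) * s t).
Proof.
move=> v_eq; split; last by exists v.
move=> g; rewrite rmorph_sum; have [h [hg gh]] := gal_inv g.
rewrite [RHS](reindex (act g)) /=.
  by apply: eq_bigr => t _; rewrite rmorphM tau_c tau_s v_eq.
by exists (act h) => t _; apply: (act_cancel act_mul act_cont).
Qed.

(** The indicator function of t is an L-combination of equivariant functions, and an equivariant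
    system of coefficients turns the family [s] into an invariant sum. *)
Lemma speiser t : exists2 ms : seq M,
  {in ms, forall m, invariant_comb m} & comb scalars ms (s t).
Proof.
suff : forall f, equivariant_span act f -> exists2 ms : seq M,
    {in ms, forall m, invariant_comb m} & comb scalars ms
      (\sum_t c (f t) * s t).
  move=> /(_ _ (equivariant_span_delta hL act_mul act_cont t)).
  rewrite (bigD1 t) //= eqxx rmorph1 mul1r big1 ?addr0 // => t' /negPf ->.
  by rewrite rmorph0 mul0r.
move=> f; elim=> [g g0|a v g g' v_eq _ [ms hms hc] g'E].
  by exists [::] => //=; rewrite big1 // => i _; rewrite g0 rmorph0 mul0r.
exists ((\sum_t c (v t) * s t) :: ms).
  move=> m; rewrite inE => /orP[/eqP ->|/hms //]; exact: equivariant_invariant.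
exists (c a), (\sum_t c (g t) * s t); split=> //; first by exists a.
rewrite mulr_sumr -big_split; apply: eq_bigr => i _ /=.
by rewrite g'E rmorphD rmorphM mulrDl mulrA.
Qed.

End Speiser.

(** * Quotients of a permuted family by affine maps *)

Section MpolyEval.
Variables (n : nat) (R : comNzRingType) (S : comNzRingType).

Lemma mmap_unique (f : {rmorphism {mpoly R[n]} -> S}) p :
  f p = mmap (f \o @mpolyC n R) (fun i => f 'X_i) p.
Proof.
rewrite [in LHS](mpolyE p) rmorph_sum /mmap; apply: eq_bigr => m _.
rewrite -mul_mpolyC rmorphM /=; congr (_ * _).
by rewrite mpolyXE_id rmorph_prod; apply: eq_bigr => i _; rewrite rmorphXn.
Qed.

Lemma eq_mmap (f g : R -> S) (h k : 'I_n -> S) (p : {mpoly R[n]}) :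
  f =1 g -> h =1 k -> mmap f h p = mmap g k p.
Proof.
move=> fg hk; apply: eq_bigr => m _; rewrite fg; congr (_ * _).
by apply: eq_bigr => i _; rewrite hk.
Qed.

End MpolyEval.

Lemma rmorph_mmap (n : nat) (R S R' : comNzRingType) (c : {rmorphism R -> S})
  (h : 'I_n -> S)
    (f : {rmorphism S -> R'}) p :
  f (mmap c h p) = mmap (f \o c) (fun i => f (h i)) p.
Proof.
rewrite -[LHS]/((f \o mmap c h) p) mmap_unique; apply: eq_mmap => [a|i] /=.
  by rewrite mmapC.
by rewrite mmapX mmap1U.
Qed.

Section FractionEval.
Variables (R : idomainType) (M : fieldType) (h : {rmorphism R -> M}).
Hypothesis h_inj : forall p, h p = 0 -> p = 0.

Let h0 p : (h p == 0) = (p == 0).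
Proof. by apply/eqP/eqP => [/h_inj|->]; rewrite ?rmorph0. Qed.

Lemma frac_surj (z : {fraction R}) : exists a b, b != 0 /\ z = a%:F / b%:F.
Proof.
by exists (frac (generic_quotient.repr z)).1,
  (frac (generic_quotient.repr z)).2;
  split; [exact: denom_ratioP | exact: frac_numden].
Qed.

Lemma fraction_eval : exists phi : {rmorphism {fraction R} -> M},
  forall p, phi p%:F = h p.
Proof.
pose phi (z : {fraction R}) := let r :=
  generic_quotient.repr z in h (frac r).1 / h (frac r).2 : M.
have phiE (a b : R) : b != 0 -> phi (a%:F / b%:F) = h a / h b.
  move=> b0; rewrite /phi; have := frac_numden (a%:F / b%:F).
  set r := generic_quotient.repr _ => /= /eqP; have r0 := denom_ratioP r.
  rewrite eqr_div ?tofrac_eq0 // -!rmorphM tofrac_eq => /eqP E.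
  by apply/eqP; rewrite eqr_div ?h0 // -!rmorphM /= -E.
have phi_tofrac p : phi p%:F = h p.
  by rewrite -[p%:F]divr1 -(rmorph1 (@FracField.tofrac _)) phiE ?oner_neq0 //
    rmorph1 divr1.
have phi_zmod : zmod_morphism phi.
  move=> x y; have [a [b [b0 ->]]] := frac_surj x; have [a' [b' [b'0 ->]]] :=
    frac_surj y.
  rewrite -mulNr addf_div ?tofrac_eq0 // -rmorphN -!rmorphM -rmorphD.
  rewrite !phiE ?mulf_neq0 // -mulNr addf_div ?h0 //.
  by rewrite rmorphD !rmorphM rmorphN /=.
have phi_mon : monoid_morphism phi.
  split=> [|x y]; first by rewrite -(rmorph1 (@FracField.tofrac _)) phi_tofrac
    rmorph1.
  have [a [b [b0 ->]]] := frac_surj x; have [a' [b' [b'0 ->]]] := frac_surj y.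
  by rewrite mulf_div -!rmorphM !phiE ?mulf_neq0 // !rmorphM /= mulf_div.
pose fz := GRing.isZmodMorphism.Build _ _ phi phi_zmod.
pose fm := GRing.isMonoidMorphism.Build _ _ phi phi_mon.
pose phiM : {rmorphism {fraction R} -> M} := HB.pack phi fz fm.
by exists phiM.
Qed.

End FractionEval.

(** Independence makes X_j -> w_j an embedding of the field of fractions of the polynomial ring. It
    carries the subfield generated by the X_j / X_i, the function field of projective space, onto
    the one generated by the w_j / w_0. *)
Lemma projective_space_birational (k : fieldType) (Y : variety k) (d : nat)
    (w : 'I_d.+1 -> ambient Y) :
  (forall p : {mpoly k[d.+1]}, mmap (@Defs.scalar k Y) w p = 0 -> p = 0) ->
  (forall z, funfield z <->
     frac_of (gen_alg (@Defs.scalar k Y) (fun z => exists j, z = w j / w ord0))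
       z) ->
  birational (projective_space k d) Y.
Proof.
move=> w_indep funY; have [phi phi_eval] := fraction_eval w_indep.
have phiE p : phi p%:F = mmap (@Defs.scalar k Y) w p := phi_eval p.
have phiC a : phi (frac_mpolyC d.+1 k a) = Defs.scalar Y a by rewrite /=
  phiE mmapC.
have phiX j : phi ('X_j)%:F = w j by rewrite phiE mmapX mmap1U.
have w0 : w ord0 != 0.
  apply/eqP => w0; have : 'X_ord0 = 0 :> {mpoly k[d.+1]}.
    by apply: w_indep; rewrite mmapX mmap1U.
  by move/mpolyP/(_ U_(ord0)%MM)/eqP; rewrite mcoeffXU eqxx mcoeff0 oner_eq0.
pose c := @Defs.scalar k Y; pose S := fun z => exists j, z = w j / w ord0.
have hFY : subfield (frac_of (gen_alg c S)) := frac_of_subfield c S.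
have ratio i j : frac_of (gen_alg c S) (w j / w i).
  have -> : w j / w i = (w j / w ord0) / (w i / w ord0).
    by rewrite invf_div mulrA divfK.
  by apply: (subfield_div hFY); apply/frac_of_sub/gen_in; [exists j | exists i].
exists phi; split=> //; try by move=> *; rewrite ?rmorphD ?rmorphM.
- by move=> x y _ _ /fmorph_inj.
split=> [x [i]|y].
  move=> hx; apply/funY.
  pose Q z := frac_of (gen_alg c S) (phi z).
  apply: (frac_of_min (Q := Q)) hx.
  + split; rewrite /Q.
    * by rewrite rmorph1; apply: subfield1.
    * by move=> a b ha hb; rewrite rmorphB; apply: subfieldB.
    * by move=> a b ha hb; rewrite rmorphM; apply: subfieldM.
    * by move=> a ha; rewrite fmorphV; apply: subfieldV.
  + by move=> a; rewrite /Q phiC; apply/frac_of_sub/gen_const.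
  + by move=> _ [j ->]; rewrite /Q fmorph_div !phiX; apply: ratio.
move/funY => hy.
pose P0 := frac_of (gen_alg (frac_mpolyC d.+1 k)
  (fun z => exists j : 'I_d.+1, z = ('X_j)%:F / ('X_ord0)%:F)).
have hP0 : subfield P0 := frac_of_subfield _ _.
suff [x hx <-] : exists2 x, P0 x & phi x = y by exists x => //; exists ord0.
pose Q y := exists2 x, P0 x & phi x = y.
apply: (frac_of_min (Q := Q)) hy.
- split.
  + by exists 1; rewrite ?rmorph1 //; apply: subfield1.
  + by move=> _ _ [a ha <-] [b hb <-]; exists (a - b); rewrite ?rmorphB //;
      apply: subfieldB.
  + by move=> _ _ [a ha <-] [b hb <-]; exists (a * b); rewrite ?rmorphM //;
      apply: subfieldM.
  + by move=> _ [a ha <-]; exists a^-1; rewrite ?fmorphV //; apply: subfieldV.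
- by move=> a; exists (frac_mpolyC d.+1 k a) => //; apply/frac_of_sub/gen_const.
move=> _ [j ->]; exists (('X_j)%:F / ('X_ord0)%:F);
  last by rewrite fmorph_div !phiX.
by apply/frac_of_sub/gen_in; exists j.
Qed.

Section CombGen.
Variables (M : fieldType) (k : M -> Prop).
Hypothesis hk : subfield k.

Lemma comb_catl ms ms' x : comb k ms x -> comb k (ms ++ ms') x.
Proof.
elim: ms x => [|m ms IH] x /=; first by move=> ->; apply: comb0.
by move=> [a [x' [ka hx ->]]]; exists a, x'; split=> //; apply: IH.
Qed.

Lemma comb_catr ms ms' x : comb k ms' x -> comb k (ms ++ ms') x.
Proof.
move=> hx; elim: ms => //= m ms IH; exists 0, x; split=> //.
  exact: subfield0.
by rewrite mul0r add0r.
Qed.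

Lemma comb_mulr ms m x : comb k ms x -> comb k [seq m * y | y <- ms] (m * x).
Proof.
elim: ms x => [|m' ms IH] x /=; first by move=> ->; rewrite mulr0.
move=> [a [x' [ka hx ->]]]; exists a, (m * x'); split=> //; first exact: IH.
by rewrite mulrDr mulrCA.
Qed.

(** Used with the embeddings of F and L for [c0] and [c1]: the ring L[S] is spanned over L by
    F[S]. *)
Lemma comb_gen_alg (k0 k1 : fieldType) (c0 : {rmorphism k0 -> M})
    (c1 : {rmorphism k1 -> M}) (S : M -> Prop) x :
  (forall a, k (c1 a)) -> gen_alg c1 S x ->
  exists2 ms : seq M, {in ms, forall m, gen_alg c0 S m} & comb k ms x.
Proof.
move=> kc; elim=> [a|{}x Sx|{}x y _ [ms hms hx] _ [ms' hms' hy]|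
    {}x y _ [ms hms hx] _ [ms' hms' hy]].
- exists [:: 1]; first by move=> m; rewrite inE => /eqP ->; apply: gen_alg1.
  by exists (c1 a), 0; rewrite mulr1 addr0.
- exists [:: x]; first by move=> m; rewrite inE => /eqP ->; apply: gen_in.
  by apply: comb_mem; rewrite ?inE.
- exists (ms ++ ms'); first by move=> m; rewrite mem_cat => /orP[/hms|/hms'].
  by apply: comb_add => //; [apply: comb_catl | apply: comb_catr].
pose W z := exists2 ms, {in ms, forall m, gen_alg c0 S m} & comb k ms (z * y).
apply: (comb_min (W := W)) hx; rewrite /W.
  by exists [::] => //; rewrite mul0r.
move=> a m z ka hm [ms1 hms1 hz]; exists ([seq m * y | y <- ms'] ++ ms1).
  move=> u; rewrite mem_cat => /orP[/mapP[v /hms' hv ->]|/hms1 //].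
  by apply: gen_mul => //; apply: hms.
rewrite mulrDl -mulrA; apply: comb_add => //; last exact: comb_catr.
by apply: comb_catl; apply: comb_scale => //; apply: comb_mulr.
Qed.

End CombGen.

Section AffineQuotient.
Variables (F L : fieldType) (iota : {rmorphism F -> L}).
Hypothesis hL : galois_extension iota.
Variables (M : fieldType) (c : {rmorphism L -> M}).
Variable tau : Gal iota -> {rmorphism M -> M}.
Hypothesis tau_c : forall g a, tau g (c a) = c (g a).
Local Notation cF := (c \o iota : {rmorphism F -> M}).

Lemma scalars_fixed z : scalars c z -> (forall g, tau g z = z) -> exists a, z =
  cF a.
Proof.
move=> [b ->] fb; have [|a ->] := gal_fixed hL (x := b); last by exists a.
by move=> g; apply: (fmorph_inj c); rewrite -tau_c.
Qed.

Lemma gen_alg_fixed (S : M -> Prop) g : (forall x, S x -> tau g x = x) ->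
  forall m, gen_alg cF S m -> tau g m = m.
Proof.
move=> fS m; elim=> [a|x /fS //|x y _ hx _ hy|x y _ hx _ hy].
- by rewrite /= tau_c gal_fix.
- by rewrite rmorphD hx hy.
by rewrite rmorphM hx hy.
Qed.

Lemma gen_alg_scalars (S : M -> Prop) z : frac_of (gen_alg cF S) z ->
  frac_of (gen_alg c S) z.
Proof.
apply: frac_of_min; first exact: frac_of_subfield.
  by move=> a; apply: (frac_of_sub (gen_const _ _ (iota a))).
by move=> x Sx; apply/frac_of_sub/gen_in.
Qed.

Lemma descent_gen (S : M -> Prop) z :
  (forall g x, S x -> tau g x = x) ->
  (frac_of (gen_alg c S) z /\ forall g, tau g z = z) <->
    frac_of (gen_alg cF S) z.
Proof.
move=> fS; have hk := scalars_subfield c.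
have fA g := gen_alg_fixed (fS g).
split; last first.
  move=> hz; split; first exact: gen_alg_scalars.
  by case: hz => [a [b [ha hb _ ->]]] g; rewrite fmorph_div !fA.
case=> -[a [b [ha hb b0 zE]]] fz.
have kc x : scalars c (c x) by exists x.
have [ms hms hca] := comb_gen_alg hk cF kc ha.
have [ms' hms' hcb] := comb_gen_alg hk cF kc hb.
apply: (descent_frac hk (scalars_tau tau_c) (R0 := gen_alg cF S) _ _ _ _ hms
  hms' hca hcb b0) fz.
- exact: gen_alg0.
- by move=> x y; apply: gen_add.
- move=> x m kx fx hm; have [y ->] := scalars_fixed kx fx.
  by apply: gen_mul => //; apply: gen_const.
- by move=> m g; apply: fA.
by rewrite zE divfK.
Qed.

Variables (N : nat) (act : Gal iota -> 'I_N -> 'I_N) (y : 'I_N -> M).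
Hypotheses (act_mul : gal_action act) (act_cont : continuous_action act).
Hypothesis tau_y : forall g i, tau g (y i) = y (act g i).
Hypothesis y_indep : forall p : {mpoly L[N]}, mmap c y p = 0 -> p = 0.

Lemma indep_inj : injective y.
Proof.
move=> i j yij; apply/eqP; have : 'X_i - 'X_j = 0 :> {mpoly L[N]}.
  by apply: y_indep; rewrite rmorphB /= !mmapX !mmap1U yij subrr.
move/mpolyP/(_ U_(j)%MM)/eqP; rewrite mcoeffB !mcoeffXU eqxx mcoeff0.
by case: (eqVneq i j) => // _; rewrite mulr0n sub0r oppr_eq0 oner_eq0.
Qed.

(** Equal indices in the denominator are harmless: the quotient is then 0. *)
Definition diff_ratio (z : M) := exists i j k l, z = (y i - y j) / (y k - y l).

Let lin (b : 'rV[L]_N) := \sum_i c (b 0 i) * y i.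

Let linD b b' : lin (b + b') = lin b + lin b'.
Proof.
by rewrite /lin -big_split; apply: eq_bigr => i _; rewrite mxE rmorphD mulrDl.
Qed.
Let linZ a b : lin (a *: b) = c a * lin b.
Proof.
by rewrite /lin mulr_sumr; apply: eq_bigr => i _; rewrite mxE rmorphM mulrA.
Qed.
Let lin0 : lin 0 = 0.
Proof. by rewrite /lin big1 // => i _; rewrite mxE rmorph0 mul0r. Qed.
Let lin_delta i : lin (delta_mx 0 i) = y i.
Proof.
rewrite /lin (bigD1 i) //= mxE !eqxx rmorph1 mul1r big1 ?addr0 // => j /negPf
  ji.
by rewrite mxE eqxx ji rmorph0 mul0r.
Qed.
Let lin_mul m (v : 'rV[L]_m) (B : 'M[L]_(m, N)) :
  lin (v *m B) = \sum_j c (v 0 j) * lin (row j B).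
Proof.
rewrite mulmx_sum_row; elim/big_rec2: _ => [|j x y' _ <-]; first exact: lin0.
by rewrite linD linZ.
Qed.

Let act2 g (t : 'I_N * 'I_N) := (act g t.1, act g t.2).
Let diff (t : 'I_N * 'I_N) := y t.1 - y t.2.

Lemma affine_quotient_rational (i0 i1 : 'I_N) : i0 != i1 ->
  exists d (w : 'I_d.+1 -> M),
    [/\ forall g j, tau g (w j) = w j,
        forall p : {mpoly F[d.+1]}, mmap cF w p = 0 -> p = 0
      & forall z, (frac_of (gen_alg c diff_ratio) z /\ forall g, tau g z = z)
        <->
          frac_of (gen_alg cF (fun z => exists j, z = w j / w ord0)) z].
Proof.
move=> i01; have act2_mul : gal_action act2.
  by move=> g h gh ghE t; rewrite /act2 !(act_mul ghE).
have act2_cont : continuous_action act2.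
  by have [s hs] := act_cont; exists s => g gs [i j]; rewrite /act2 !hs.
have tau_diff g t : tau g (diff t) = diff (act2 g t).
  by rewrite /diff rmorphB !tau_y.
have sp := speiser hL tau_c act2_mul act2_cont tau_diff.
have [ms hms ms_span] : exists2 ms : seq M,
    {in ms, forall m, invariant_comb c tau diff m} &
    forall t, comb (scalars c) ms (diff t).
  suff [ms hms h] : exists2 ms : seq M,
    {in ms, forall m, invariant_comb c tau diff m} &
      forall t, t \in enum {: 'I_N * 'I_N} -> comb (scalars c) ms (diff t).
    by exists ms => // t; apply: h; rewrite mem_enum.
  elim: (enum _) => [|t q [ms hms IH]].
    by exists [::] => [m|t]; rewrite in_nil.
  have [ms' hms' ht] := sp t; exists (ms' ++ ms).
    by move=> m; rewrite mem_cat => /orP[/hms'|/hms].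
  move=> t'; rewrite inE => /orP[/eqP ->|/IH]; first
    exact: comb_catl (scalars_subfield c) _ _ _ ht.
  by apply: comb_catr; apply: scalars_subfield.
have lin_ms m : m \in ms -> exists b, m = lin b.
  move=> /hms[_ [v ->]].
  exists (\sum_t v t *: (delta_mx 0 t.1 - delta_mx 0 t.2)).
  elim/big_rec2: _ => [|t x x' _ ->]; first by rewrite lin0.
  rewrite linD linZ linD -scaleN1r linZ rmorphN1 mulN1r !lin_delta.
  by [].
pose K := size ms.
have [V VE] : exists V : 'M[L]_(K, N), forall i : 'I_K, ms`_i = lin (row i V).
  have lin_i (i : 'I_K) : exists b, ms`_i = lin b by apply/lin_ms/mem_nth.
  exists (\matrix_i sval (cid (lin_i i))) => i.
  by rewrite rowK; case: cid.
have diff_V t : exists2 u : 'rV_N, diff t = lin u & (u <= V)%MS.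
  apply: (comb_min (W := fun x => exists2 u : 'rV_N, x = lin u & (u <= V)%MS))
    (ms_span t).
    by exists 0; rewrite ?lin0 ?sub0mx.
  move=> _ m x [a ->] hm [u -> uV]; have iK : (index m ms < K)%N
    by rewrite index_mem.
  exists (a *: row (Ordinal iK) V + u).
    by rewrite linD linZ -VE /= nth_index.
  by apply: addmx_sub => //; apply: scalemx_sub; apply: row_sub.
(* Two distinct points have a nonzero difference; the rank is therefore of the form d.+1. *)
have rkV : \rank V != 0%N.
  apply/eqP => /eqP; rewrite mxrank_eq0 => /eqP V0.
  have [u uE] := diff_V (i0, i1); rewrite V0 => /submx0null u0.
  move/eqP: uE; rewrite u0 lin0 subr_eq0 => /eqP /indep_inj /eqP.
  by rewrite (negPf i01).
(* The basis is selected among the rows of [V], that is among the invariant elements of [ms], so it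
   consists of invariants. *)
pose f := maxrankfun V; pose B := rowsub f V.
have B_free : row_free B := maxrowsub_free V.
have diff_B t : exists v : 'rV_(\rank V), diff t =
  \sum_j c (v 0 j) * lin (row j B).
  have [u -> uV] := diff_V t; have uB : (u <= B)%MS by rewrite eq_maxrowsub.
  by exists (u *m pinvmx B); rewrite -lin_mul mulmxKpV.
have B_ms j : lin (row j B) = ms`_(f j).
  by rewrite VE; congr lin; apply/rowP => i; rewrite !mxE.
move: {diff_V} (\rank V) rkV f B B_free diff_B B_ms => [//|d] _ f B B_free
  diff_B B_ms.
pose w j := lin (row j B).
have w_ms j : w j \in ms by rewrite /w B_ms mem_nth.
have w_fixed g j : tau g (w j) = w j by have [-> _] := hms _ (w_ms j).
(* The w_j are the linear forms with matrix [B] in the independent y_i. As [B] has a right inverse,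
   the substitution [Z] turns these forms back into variables, and a relation among the w_j becomes
   one among variables. *)
have w_indep (p : {mpoly F[d.+1]}) : mmap cF w p = 0 -> p = 0.
  pose X j : {mpoly L[N]} := \sum_i B j i *: 'X_i.
  pose p' := mmap (@mpolyC N L \o iota) X p.
  have yX j : mmap c y (X j) = w j.
    rewrite /X rmorph_sum /w /lin; apply: eq_bigr => i _ /=.
    by rewrite mmapZ mmapX mmap1U mxE.
  have -> : mmap cF w p = mmap c y p'.
    rewrite /p' rmorph_mmap; apply: eq_mmap => [a|j] /=; first by rewrite mmapC.
    by rewrite yX.
  move=> /y_indep p'0.
  pose Z i : {mpoly L[d.+1]} := \sum_k pinvmx B i k *: 'X_k.
  have ZX j : mmap (@mpolyC d.+1 L) Z (X j) = 'X_j.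
    rewrite /X rmorph_sum /=.
    under eq_bigr => i _ do rewrite mmapZ mmapX mmap1U mulr_sumr.
    rewrite exchange_big /= (bigD1 j) //= [X in _ + X]big1 ?addr0.
      have /matrixP/(_ j j) := mulmxVp B_free; rewrite !mxE eqxx => E.
      under eq_bigr => i _ do rewrite mul_mpolyC scalerA.
      by rewrite -scaler_suml E scale1r.
    move=> k /negPf kj; have /matrixP/(_ j k) := mulmxVp B_free;
      rewrite !mxE eq_sym kj => E.
    under eq_bigr => i _ do rewrite mul_mpolyC scalerA.
    by rewrite -scaler_suml E scale0r.
  have : mmap (@mpolyC d.+1 L) Z p' = 0 by rewrite p'0 rmorph0.
  rewrite /p' rmorph_mmap => E.
  have {}E : map_mpoly iota p = 0.
    rewrite -E; apply: eq_mmap => [a|j] /=; first by rewrite mmapC.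
    by rewrite ZX.
  apply/mpolyP => m; apply: (fmorph_inj iota).
  by rewrite -mcoeff_map_mpoly E !mcoeff0 rmorph0.
exists d, w; split=> // z; rewrite -descent_gen; last first.
  by move=> g _ [j ->]; rewrite fmorph_div !w_fixed.
pose S := diff_ratio; pose S' z := exists j, z = w j / w ord0.
have hS := frac_of_subfield c S; have hS' := frac_of_subfield c S'.
suff E : forall z, frac_of (gen_alg c S) z <-> frac_of (gen_alg c S') z.
  by split=> -[hz fz]; split=> //; apply/E.
apply: eq_frac_of_gen.
- move=> _ [i [j [k [l ->]]]].
  have w0 : w ord0 != 0.
    apply/eqP => w0; have : 'X_ord0 = 0 :> {mpoly F[d.+1]}.
      by apply: w_indep; rewrite mmapX mmap1U.
    by move/mpolyP/(_ U_(ord0)%MM)/eqP; rewrite mcoeffXU eqxx mcoeff0 oner_eq0.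
  have hd t : frac_of (gen_alg c S') (diff t / w ord0).
    have [v ->] := diff_B t; rewrite mulr_suml;
      apply: (subfield_sum hS') => j' _.
    rewrite -mulrA; apply: (subfieldM hS'); first exact/frac_of_sub/gen_const.
    by apply/frac_of_sub/gen_in; exists j'.
  have -> : (y i - y j) / (y k - y l) =
    (diff (i, j) / w ord0) / (diff (k, l) / w ord0).
    by rewrite invf_div mulrA divfK.
  exact: subfield_div.
move=> _ [j ->].
have d01 : diff (i0, i1) != 0.
  by rewrite subr_eq0 (inj_eq indep_inj).
have hw j' : frac_of (gen_alg c S) (w j' / diff (i0, i1)).
  have [_ [v ->]] := hms _ (w_ms j'); rewrite mulr_suml;
    apply: (subfield_sum hS) => t _.
  rewrite -mulrA; apply: (subfieldM hS); first exact/frac_of_sub/gen_const.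
  by apply/frac_of_sub/gen_in; exists t.1, t.2, i0, i1.
have -> : w j / w ord0 = (w j / diff (i0, i1)) / (w ord0 / diff (i0, i1)).
  by rewrite invf_div mulrA divfK.
exact: subfield_div.
Qed.

End AffineQuotient.

(** * Cross-ratios *)

Section PolyFrac.
Variables (M : fieldType) (k : M -> Prop) (u : M).
Hypothesis hk : subfield k.

(** The field k(u). The transcendence of u is a separate matter, so the denominator is required to
    be nonzero at u. *)
Definition poly_frac (z : M) := exists A B : {poly M},
  [/\ forall i, k A`_i, forall i, k B`_i, B.[u] != 0 & z = A.[u] / B.[u]].

Lemma poly_frac_const a : k a -> poly_frac a.
Proof.
move=> ka; exists a%:P, 1; rewrite !hornerC oner_neq0 divr1.
by split=> //; apply: (subfield_coefC hk) => //; apply: subfield1.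
Qed.

Lemma poly_frac_gen : poly_frac u.
Proof.
exists 'X, 1; rewrite hornerX hornerC oner_neq0 divr1; split=> //.
  exact: subfield_coefX.
by apply: (subfield_coefC hk); apply: subfield1.
Qed.

Lemma poly_frac_subfield : subfield poly_frac.
Proof.
split.
- by apply: poly_frac_const; apply: subfield1.
- move=> _ _ [A [B [hA hB B0 ->]]] [A' [B' [hA' hB' B'0 ->]]].
  exists (A * B' - A' * B), (B * B'); rewrite hornerD hornerN !hornerM; split.
  + by move=> i; rewrite coefB; apply: (subfieldB hk);
      apply: (subfield_coefM hk).
  + exact: (subfield_coefM hk).
  + by rewrite mulf_neq0.
  by field; rewrite B0 B'0.
- move=> _ _ [A [B [hA hB B0 ->]]] [A' [B' [hA' hB' B'0 ->]]].
  exists (A * A'), (B * B'); rewrite !hornerM; split;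
    try exact: (subfield_coefM hk).
    by rewrite mulf_neq0.
  by field; rewrite B0 B'0.
move=> _ [A [B [hA hB B0 ->]]]; have [->|A0] := eqVneq A.[u] 0.
  by rewrite mul0r invr0; apply: poly_frac_const; apply: subfield0.
by exists B, A; rewrite invf_div; split.
Qed.

Lemma poly_frac_min (Q : M -> Prop) : subfield Q -> (forall a, k a -> Q a) ->
  Q u ->
  forall z, poly_frac z -> Q z.
Proof.
move=> hQ kQ Qu z [A [B [hA hB _ ->]]]; apply: (subfield_div hQ);
  apply: (subfield_horner hQ) => // i; exact: kQ.
Qed.

End PolyFrac.

Lemma comb_horner (M : fieldType) (k : M -> Prop) (A : {poly M}) (u : M) :
  (forall i, k A`_i) -> comb k [seq u ^+ i | i <- iota 0 (size A)] A.[u].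
Proof.
move=> hA; rewrite horner_coef -(big_mkord xpredT (fun i => A`_i * u ^+ i)).
rewrite /index_iota subn0; elim: (iota _ _) => [|i s IH] /=;
  first by rewrite big_nil.
by rewrite big_cons; exists A`_i; eexists; split; [| exact: IH |].
Qed.

(** Polynomials in u are combinations of the powers of u, which are invariant, so [descent_frac]
    applies. *)
Lemma descent_poly_frac (M : fieldType) (G : Type)
  (tau : G -> {rmorphism M -> M})
    (k : M -> Prop) (u : M) :
  subfield k -> (forall g a, k a -> k (tau g a)) -> (forall g, tau g u = u) ->
  forall z, (poly_frac k u z /\ forall g, tau g z = z) <->
    poly_frac (fun a => k a /\ forall g, tau g a = a) u z.
Proof.
move=> hk k_tau fu z; set kG := fun a => _ /\ _.
have hkG : subfield kG := subfield_fixed tau hk.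
split=> [[[A [B [hA hB B0 zE]]] fz]|hz]; last first.
  split; last first.
    move=> g; apply: (poly_frac_min (Q := fun x => tau g x = x))
      hz => [|a [_ ->]|] //.
    split; first by rewrite rmorph1.
    - by move=> x y hx hy; rewrite rmorphB hx hy.
    - by move=> x y hx hy; rewrite rmorphM hx hy.
    by move=> x hx; rewrite fmorphV hx.
  apply: (poly_frac_min (poly_frac_subfield u hk)) hz;
    last exact: poly_frac_gen.
  by move=> a [ka _]; apply: poly_frac_const.
pose R0 x := exists2 A : {poly M}, (forall i, kG A`_i) & x = A.[u].
have R0_pow n : {in [seq u ^+ i | i <- iota 0 n], forall m, R0 m}.
  move=> _ /mapP[i _ ->]; exists 'X^i; last by rewrite hornerXn.
  by move=> j; rewrite coefXn; case: eqP => _;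
    [apply: subfield1 | apply: subfield0].
have [|||||a' [b' [[A' hA' ->] [B' hB' ->] b'0 ->]]] :=
  descent_frac hk k_tau (R0 := R0) _ _ _ _ (R0_pow _) (R0_pow _)
    (comb_horner u hA) (comb_horner u hB) B0 (z := z) _ fz.
- by exists 0; rewrite ?horner0 // => i; rewrite coef0; apply: subfield0.
- move=> _ _ [P hP ->] [P' hP' ->]; exists (P + P'); rewrite ?hornerD // => i.
  by rewrite coefD; apply: (subfieldD hkG).
- move=> a _ ka fa [P hP ->]; exists (a *: P); rewrite ?hornerZ // => i.
  by rewrite coefZ; apply: (subfieldM hkG).
- move=> _ g [P hP ->]; rewrite -horner_map fu; congr _.[_].
  by apply/polyP => i; rewrite coef_map /=; have [_ ->] := hP i.
- by rewrite zE divfK.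
by exists A', B'.
Qed.

Section CrossRatios.
Variables (L M : fieldType) (c : {rmorphism L -> M}) (n : nat) (y : 'I_n -> M).
Hypothesis y_inj : injective y.

Let yneq i j : i != j -> y i - y j != 0.
Proof. by rewrite subr_eq0 (inj_eq y_inj). Qed.

Definition cross i j k l := ((y i - y k) * (y j - y l)) /
  ((y i - y l) * (y j - y k)).

Definition is_cross z := exists i j k l, uniq [:: i; j; k; l] /\ z =
  cross i j k l.

Definition cross_field := frac_of (gen_alg c is_cross).
Definition diff_field := frac_of (gen_alg c (diff_ratio y)).

Lemma cross_field_subfield : subfield cross_field.
Proof. exact: frac_of_subfield. Qed.
Lemma diff_field_subfield : subfield diff_field.
Proof. exact: frac_of_subfield. Qed.
Local Notation hK := cross_field_subfield.
Local Notation hD := diff_field_subfield.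

Lemma cross_field_const a : cross_field (c a).
Proof. exact/frac_of_sub/gen_const. Qed.

Lemma cross_mem i j k l : uniq [:: i; j; k; l] -> cross_field (cross i j k l).
Proof. by move=> u; apply/frac_of_sub/gen_in; exists i, j, k, l. Qed.

Lemma diff_ratio_mem i j k l : diff_field ((y i - y j) / (y k - y l)).
Proof. by apply/frac_of_sub/gen_in; exists i, j, k, l. Qed.

Lemma cross_field_sub z : cross_field z -> diff_field z.
Proof.
apply: frac_of_min; first exact: hD.
  by move=> a; apply/frac_of_sub/gen_const.
move=> _ [i [j [k [l [_ ->]]]]]; rewrite /cross -mulf_div.
by apply: (subfieldM hD); apply: diff_ratio_mem.
Qed.

(* Any n points of the projective line are the images of points [p i : q i]
   with coordinates in the field of cross-ratios under a projective
   transformation; here l i is the denominator of the transformation at the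
   i-th point. *)
Section Frame.
Variables r0 r1 r2 : 'I_n.
Hypotheses (r01 : r0 != r1) (r02 : r0 != r2) (r12 : r1 != r2).

(** The map y -> [frame_c] * (y - y r1) / (y r0 - y) sends y r0, y r1, y r2 to infinity, 0, 1, and
    infinity to -[frame_c]. Hence [frame_l] i is the determinant of the i-th point [p i : q i] and
    the image [-[frame_c] : 1] of infinity. *)
Definition frame_c := (y r0 - y r2) / (y r2 - y r1).
Definition frame_mu := frame_c * (y r0 - y r1).
Definition frame_p i :=
  if i == r0 then 1 else frame_c * (y i - y r1) / (y r0 - y i).
Definition frame_q i : M := if i == r0 then 0 else 1.
Definition frame_l i := frame_p i + frame_q i * frame_c.

Lemma frame_p_mem i : cross_field (frame_p i).
Proof.
rewrite /frame_p /frame_c; have [_|i0] := eqVneq i r0;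
  first exact: subfield1 hK.
have [->|i1] := eqVneq i r1; first by rewrite subrr mulr0 mul0r;
  apply: subfield0 hK.
have [->|i2] := eqVneq i r2.
  rewrite divfK ?divff ?yneq //; first exact: subfield1 hK.
  by rewrite eq_sym.
have -> : (y r0 - y r2) / (y r2 - y r1) * (y i - y r1) / (y r0 - y i) =
  cross r0 r1 r2 i.
  rewrite /cross; field.
  by rewrite !yneq // eq_sym.
by apply: cross_mem; rewrite /= !inE !negb_or r01 r02 r12 !(eq_sym _ i) i0 i1
  i2.
Qed.

Lemma frame_q_mem i : cross_field (frame_q i).
Proof.
by rewrite /frame_q; case: eqP => _;
  [exact: subfield0 hK | exact: subfield1 hK].
Qed.

Lemma frame_c_mem : diff_field frame_c. Proof. exact: diff_ratio_mem. Qed.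

Lemma frame_c_neq0 : frame_c != 0.
Proof. by rewrite mulf_neq0 ?invr_eq0 ?yneq // eq_sym. Qed.

Lemma frame_mu_neq0 : frame_mu != 0.
Proof. by rewrite mulf_neq0 ?frame_c_neq0 ?yneq. Qed.

Lemma frame_lE i : i != r0 -> frame_l i = frame_mu / (y r0 - y i).
Proof.
move=> i0; rewrite /frame_l /frame_p /frame_q (negPf i0) /frame_mu mul1r.
by field; rewrite yneq // eq_sym.
Qed.

Lemma frame_l_neq0 i : frame_l i != 0.
Proof.
have [->|i0] := eqVneq i r0.
  by rewrite /frame_l /frame_p /frame_q eqxx mul0r addr0 oner_neq0.
by rewrite frame_lE // mulf_neq0 ?frame_mu_neq0 // invr_eq0 yneq // eq_sym.
Qed.

Definition frame_det i j := frame_p i * frame_q j - frame_p j * frame_q i.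

Lemma frame_det_mem i j : cross_field (frame_det i j).
Proof.
apply: (subfieldB hK); apply: (subfieldM hK); first
  [exact: frame_p_mem | exact: frame_q_mem].
Qed.

(** y i - y j is the determinant of [y i : 1] and [y j : 1]. The change of frame multiplies it by
    the determinant [frame_mu] of the transformation and by the scaling factor of each point. *)
Lemma frame_diff i j :
  y i - y j = frame_mu * frame_det i j / (frame_l i * frame_l j).
Proof.
have h0 k : k != r0 -> y r0 - y k = frame_mu / frame_l k.
  by move=> k0; rewrite frame_lE // invf_div mulrC divfK ?frame_mu_neq0.
have l0 : frame_l r0 = 1 by rewrite /frame_l /frame_p /frame_q eqxx mul0r addr0.
have [->|i0] := eqVneq i r0.
  rewrite l0 mul1r /frame_det /frame_p /frame_q eqxx.
  have [->|j0] := eqVneq j r0; first by rewrite !(mulr0, subrr, mul0r).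
  by rewrite mulr1 mulr0 subr0 mulr1 h0.
have [->|j0] := eqVneq j r0.
  rewrite l0 mulr1 /frame_det /frame_p /frame_q eqxx (negPf i0).
  by rewrite mulr0 mul1r sub0r mulrN1 mulNr -h0 // opprB.
have -> : y i - y j = (y r0 - y j) - (y r0 - y i) by ring.
rewrite !h0 // /frame_det /frame_q (negPf i0) (negPf j0) !mulr1.
have -> : frame_p i - frame_p j = frame_l i - frame_l j.
  by rewrite /frame_l /frame_q (negPf i0) (negPf j0); ring.
by field; rewrite !frame_l_neq0.
Qed.

Lemma frame_det_neq0 i j : i != j -> frame_det i j != 0.
Proof.
move=> ij; apply: contraNneq (yneq ij) => d0.
by rewrite frame_diff d0 mulr0 mul0r.
Qed.

Hypothesis c_notin : ~ cross_field frame_c.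

(** A ratio x in K0 gives the linear equation p_i + q_i c = x (p_j + q_j c) over K0. It would
    determine c in K0 unless its coefficients vanish, and then the points i and j would coincide. *)
Lemma frame_l_ratio i j : i != j -> ~ cross_field (frame_l i / frame_l j).
Proof.
move=> ij; set x := _ / _ => hx; have xE : frame_l i = x * frame_l j.
  by rewrite /x divfK ?frame_l_neq0.
have [q0|q0] := eqVneq (frame_q i - x * frame_q j) 0; last first.
  apply: c_notin.
  have -> : frame_c = (x * frame_p j - frame_p i) / (frame_q i - x * frame_q j).
    apply: (mulIf q0); rewrite divfK // ; move: xE; rewrite /frame_l => xE.
    apply/eqP; rewrite -subr_eq0; apply/eqP; move/eqP: xE;
      rewrite -subr_eq0 => /eqP <-.
    by ring.
  apply: (subfield_div hK); apply: (subfieldB hK);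
    try apply: (subfieldM hK) => //;
    solve [exact: frame_p_mem | exact: frame_q_mem].
have qE : frame_q i = x * frame_q j by apply/eqP; rewrite -subr_eq0 q0.
have pE : frame_p i = x * frame_p j.
  have -> : frame_p i = frame_l i - frame_q i * frame_c by rewrite /frame_l;
    ring.
  by rewrite xE qE /frame_l; ring.
by move/eqP: (frame_det_neq0 ij); apply; rewrite /frame_det pE qE; ring.
Qed.

End Frame.
End CrossRatios.

Section PointAtInfinity.
Variables (L M : fieldType) (c : {rmorphism L -> M}) (n : nat) (y : 'I_n -> M).
Hypothesis y_inj : injective y.
Variable i0 : 'I_n.

Definition from_pole (k : 'I_n.-1) : M := (y (lift i0 k) - y i0)^-1.

Let yneq i j : i != j -> y i - y j != 0.
Proof. by rewrite subr_eq0 (inj_eq y_inj). Qed.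

Let lneq k : y (lift i0 k) - y i0 != 0.
Proof. by rewrite yneq // eq_sym neq_lift. Qed.

Lemma from_pole_inj : injective from_pole.
Proof. by move=> k l /invr_inj /addIr /y_inj /lift_inj. Qed.

(** With y i0 at infinity, (a - b) / (a - d) is a cross-ratio of a, b, d and infinity, and every
    ratio of differences is a product of two such. Conversely a cross-ratio is written in
    differences according to whether, and where, [i0] occurs in it. *)
Lemma diff_field_from_pole z : diff_field c from_pole z <-> cross_field c y z.
Proof.
have hK := cross_field_subfield c y; have hD := diff_field_subfield c from_pole.
apply: eq_frac_of_gen.
- have ratio i j l : cross_field c y
    ((from_pole i - from_pole j) / (from_pole i - from_pole l)).
    have [->|ij] := eqVneq i j; first by rewrite subrr mul0r;
      apply: subfield0 hK.
    have [->|il] := eqVneq i l; first by rewrite subrr invr0 mulr0;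
      apply: subfield0 hK.
    have [->|jl] := eqVneq j l.
      rewrite divff ?subr_eq0 ?(inj_eq from_pole_inj) //;
        first exact: subfield1 hK.
    have li k l' : k != l' -> lift i0 k !=
      lift i0 l' by rewrite (inj_eq lift_inj).
    have -> : (from_pole i - from_pole j) / (from_pole i - from_pole l) =
        cross y (lift i0 i) i0 (lift i0 j) (lift i0 l).
      rewrite /from_pole /cross; field.
      have -> : y (lift i0 l) - y i0 + -1 * (y (lift i0 i) - y i0) =
          y (lift i0 l) - y (lift i0 i) by ring.
      by rewrite !lneq -(opprB _ (y i0)) oppr_eq0 lneq !yneq ?li // eq_sym.
    apply: cross_mem; rewrite /= !inE !negb_or !li // neq_lift andbT /=.
    by rewrite !(eq_sym (lift i0 _) i0) !neq_lift.
  move=> _ [i [j [k [l ->]]]].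
  have [->|il] := eqVneq i l.
    rewrite -[from_pole k - _]opprB invrN mulrN; apply: (subfieldN hK);
      exact: ratio.
  have -> : (from_pole i - from_pole j) / (from_pole k - from_pole l) =
     (from_pole i - from_pole j) / (from_pole i - from_pole l) *
     ((from_pole l - from_pole i) / (from_pole l - from_pole k)).
    rewrite -[from_pole l - from_pole i]opprB -[from_pole l - from_pole k]opprB.
    rewrite invrN mulrNN mulrA divfK // subr_eq0 (inj_eq from_pole_inj) //.
  by apply: (subfieldM hK); apply: ratio.
move=> _ [i [j [k [l [u ->]]]]].
have Nf s : from_pole s != 0 by rewrite invr_eq0.
have fneq s t : s != t -> from_pole s - from_pole t != 0.
  by move=> st; rewrite subr_eq0 (inj_eq from_pole_inj).
move: u; rewrite /= !inE !negb_or => /and4P[/and3P[ij ik il] /andP[jk jl] kl _].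
have ratio s t s' t' : diff_field c from_pole
   ((from_pole s - from_pole t) / (from_pole s' - from_pole t')).
  exact: diff_ratio_mem.
have d1 s : y i0 - y (lift i0 s) = - (from_pole s)^-1.
  by rewrite /from_pole invrK opprB.
have d2 s : y (lift i0 s) - y i0 = (from_pole s)^-1 by rewrite /from_pole invrK.
have d3 s t : y (lift i0 s) - y (lift i0 t) =
  (from_pole t - from_pole s) / (from_pole s * from_pole t).
  have -> : y (lift i0 s) - y (lift i0 t) =
    (y (lift i0 s) - y i0) - (y (lift i0 t) - y i0) by ring.
  by rewrite !d2; field; rewrite !Nf.
have lift_ex i' : i0 != i' -> exists s, i' = lift i0 s.
  by case: (unliftP i0 i') => [s ->|->]; [exists s | rewrite eqxx].
rewrite /cross.
have [Ei|/lift_ex[s Es]] := eqVneq i0 i.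
  move: ij ik il jk jl kl; rewrite -Ei => /lift_ex[s ->] /lift_ex[t ->]
    /lift_ex[r ->].
  rewrite !(inj_eq lift_inj) !d1 !d3 => st sr tr.
  rewrite (_ : _ / _ = (from_pole r - from_pole s) /
    (from_pole t - from_pole s)); first exact: ratio.
  by field; rewrite ?oppr_eq0 ?oner_neq0 !Nf !fneq // 1?eq_sym.
have [Ej|/lift_ex[t Et]] := eqVneq i0 j.
  move: ij jk jl ik il kl; rewrite -Ej Es eq_sym => _ /lift_ex[t ->]
    /lift_ex[r ->].
  rewrite !(inj_eq lift_inj) !d1 !d3 => st sr tr.
  rewrite (_ : _ / _ = (from_pole t - from_pole s) /
    (from_pole r - from_pole s)); first exact: ratio.
  by field; rewrite ?oppr_eq0 ?oner_neq0 !Nf !fneq // 1?eq_sym.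
have [Ek|/lift_ex[r Er]] := eqVneq i0 k.
  move: kl ij il jl; rewrite -Ek Es Et => /lift_ex[r ->].
  rewrite !(inj_eq lift_inj) !d2 !d3 => st sr tr.
  rewrite (_ : _ / _ = (from_pole r - from_pole t) /
    (from_pole r - from_pole s)); first exact: ratio.
  by field; rewrite ?oppr_eq0 ?oner_neq0 !Nf !fneq // 1?eq_sym.
have [El|/lift_ex[v Ev]] := eqVneq i0 l.
  move: ij ik jk; rewrite -El Es Et Er.
  rewrite !(inj_eq lift_inj) !d2 !d3 => st sr tr.
  rewrite (_ : _ / _ = (from_pole r - from_pole s) /
    (from_pole r - from_pole t)); first exact: ratio.
  by field; rewrite ?oppr_eq0 ?oner_neq0 !Nf !fneq // 1?eq_sym.
move: ij ik il jk jl kl; rewrite Es Et Er Ev !(inj_eq lift_inj) !d3 => ij ik il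
  jk jl kl.
rewrite (_ : _ / _ = (from_pole r - from_pole s) / (from_pole v - from_pole s) *
  ((from_pole v - from_pole t) / (from_pole r - from_pole t))).
  by apply: (subfieldM hD).
by field; rewrite ?oppr_eq0 ?oner_neq0 !Nf !fneq // 1?eq_sym.
Qed.

End PointAtInfinity.

(** * Sections of degree one on the universal conic *)

Section OddSubset.
Variables (F L : fieldType) (iota : {rmorphism F -> L}).
Hypothesis hL : galois_extension iota.
Variables (M : fieldType) (c : {rmorphism L -> M}).
Variable tau : Gal iota -> {rmorphism M -> M}.
Hypothesis tau_c : forall g a, tau g (c a) = c (g a).
Variables (n : nat) (act : Gal iota -> 'I_n -> 'I_n) (y : 'I_n -> M).
Hypotheses (act_mul : gal_action act) (act_cont : continuous_action act).
Hypothesis tau_y : forall g i, tau g (y i) = y (act g i).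
Hypothesis y_inj : injective y.
Local Notation K := (cross_field c y).
Let hK : subfield K := cross_field_subfield c y.
Let hD : subfield (diff_field c y) := diff_field_subfield c y.

Lemma gal_act_inj g : injective (act g).
Proof.
by have [h [hg _]] := gal_inv g; apply: can_inj
  (act_cancel act_mul act_cont hg).
Qed.

Lemma cross_field_tau g z : K z -> K (tau g z).
Proof.
apply: (frac_of_min (Q := fun z => K (tau g z))).
- split; first by rewrite rmorph1; apply: subfield1 hK.
  + by move=> a b ha hb; rewrite rmorphB; apply: subfieldB hK _ _ ha hb.
  + by move=> a b ha hb; rewrite rmorphM; apply: subfieldM hK _ _ ha hb.
  by move=> a ha; rewrite fmorphV; apply: subfieldV hK _ ha.
- by move=> a; rewrite tau_c; apply: cross_field_const.
move=> _ [i [j [k [l [u ->]]]]]; rewrite /cross fmorph_div !rmorphM !rmorphB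
  !tau_y.
apply: cross_mem; rewrite -[[:: _; _; _; _]]/(map (act g) [:: i; j; k; l]).
by rewrite map_inj_uniq //; apply: gal_act_inj.
Qed.

Variables r0 r1 r2 : 'I_n.
Hypotheses (r01 : r0 != r1) (r02 : r0 != r2) (r12 : r1 != r2).
Local Notation fc := (frame_c y r0 r1 r2).
Local Notation fl := (frame_l y r0 r1 r2).
Hypothesis c_notin : ~ K fc.

Variables (S : {set 'I_n}) (m : nat).
Hypotheses (S_card : #|S| = m.*2.+1) (m_gt0 : (0 < m)%N).
Hypothesis S_stable : forall g i, i \in S -> act g i \in S.

Local Notation T := {ffun 'I_m * bool -> 'I_n}.
Let actT g (f : T) : T := [ffun p => act g (f p)].
(** A predicate, with [sec] equal to 0 off it, so that the finite Galois set is the whole function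
    type [T]. *)
Let pairing (f : T) := injectiveb f && [forall p, f p \in S].

(* A section of O(S) tensored with the m-th power of the canonical bundle, a
   line bundle of degree 1 on the universal conic; the point at infinity is the
   (n+1)-st marked point. *)
Let sec (f : T) :=
  if pairing f then \prod_(k < m) (y (f (k, true)) - y (f (k, false))) else 0.

Let S_stableE g i : (act g i \in S) = (i \in S).
Proof.
apply/idP/idP => [|/S_stable //]; have [h [hg _]] := gal_inv g.
by move/(S_stable h); rewrite (act_cancel act_mul act_cont hg).
Qed.

Let tau_sec g f : tau g (sec f) = sec (actT g f).
Proof.
have -> : sec (actT g f) = if pairing f then
    \prod_(k < m) (y (act g (f (k, true))) - y (act g (f (k, false)))) else 0.
  rewrite /sec; have -> : pairing (actT g f) = pairing f.
    congr (_ && _).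
      apply/injectiveP/injectiveP => f_inj p q.
        by move=> E; apply: f_inj; rewrite !ffunE E.
      by rewrite !ffunE => /gal_act_inj /f_inj.
    by apply: eq_forallb => p; rewrite ffunE S_stableE.
  by case: ifP => // _; apply: eq_bigr => k _; rewrite !ffunE.
rewrite /sec; case: ifP => _; last exact: rmorph0.
by rewrite rmorph_prod; apply: eq_bigr => k _; rewrite rmorphB !tau_y.
Qed.

Let nu := frame_mu y r0 r1 r2 ^+ m / \prod_(i in S) fl i.

Let fl0 i : fl i != 0. Proof. exact: frame_l_neq0. Qed.
Let nu0 : nu != 0.
Proof.
by rewrite mulf_neq0 ?expf_neq0 ?frame_mu_neq0 // invr_eq0; apply/prodf_neq0.
Qed.

(** By [frame_diff] the product is mu^m times determinants in K0, divided by the product of [fl]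
    over all points of S but a. The factor [fl a] completes this to the product over S, so that [nu]
    is the same for all pairings. *)
Let sec_missing f a : pairing f -> a \in S -> (forall p, f p != a) ->
  exists ka, [/\ K ka, ka != 0 & sec f = ka * nu * fl a].
Proof.
move=> pf aS fa; have [/injectiveP f_inj /forallP fS] := andP pf.
exists (\prod_(k < m) frame_det y r0 r1 r2 (f (k, true)) (f (k, false))); split.
- by apply: (subfield_prod hK) => k _; apply: frame_det_mem.
- apply/prodf_neq0 => k _; apply: frame_det_neq0 => //.
  by rewrite (inj_eq f_inj) xpair_eqE andbF.
rewrite /sec pf /nu.
have -> : \prod_(i in S) fl i = fl a * \prod_(p : 'I_m * bool) fl (f p).
  rewrite (big_setD1 a) //=; congr (_ * _).
  have <- : f @: [set: 'I_m * bool] = S :\ a.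
    apply/eqP; rewrite eqEcard; apply/andP; split.
      by apply/subsetP => _ /imsetP[p _ ->]; rewrite !inE fa fS.
    rewrite card_imset // cardsT card_prod card_ord card_bool.
    by move: (cardsD1 a S); rewrite aS S_card muln2 => -[->].
  rewrite big_imset /=; last by move=> p q _ _; apply: f_inj.
  by apply: eq_bigl => p; rewrite inE.
have -> : \prod_p fl (f p) = \prod_(k < m)
  (fl (f (k, true)) * fl (f (k, false))).
  under [RHS]eq_bigr => k _ do rewrite -(big_bool _ (fun b => fl (f (k, b)))).
  by rewrite pair_bigA; apply: eq_bigr => -[].
have -> : \prod_(k < m) (y (f (k, true)) - y (f (k, false))) =
   \prod_(k < m) (frame_mu y r0 r1 r2 * frame_det y r0 r1 r2 (f (k, true))
     (f (k, false)) /
     (fl (f (k, true)) * fl (f (k, false)))).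
  by apply: eq_bigr => k _; apply: frame_diff.
rewrite prodf_div big_split /= prodr_const card_ord.
set P := \prod_(k < m) (fl _ * fl _).
have P0 : P != 0 by apply/prodf_neq0 => k _; rewrite mulf_neq0.
by field; rewrite P0 fl0.
Qed.

Let missing_ex a : a \in S -> exists2 f, pairing f & forall p, f p != a.
Proof.
move=> aS; have card_eq : #|{: 'I_m * bool}| = #|S :\ a|.
  by move: (cardsD1 a S); rewrite aS S_card card_prod card_ord card_bool
    muln2 => -[].
pose f : T := [ffun p => enum_val (cast_ord card_eq (enum_rank p))].
have fD p : f p \in S :\ a by rewrite ffunE; apply: enum_valP.
exists f; last by move=> p; have := fD p; rewrite !inE => /andP[].
apply/andP; split; last by apply/forallP => p; have := fD p;
  rewrite !inE => /andP[].
by apply/injectiveP => p q; rewrite !ffunE => /enum_val_inj /cast_ord_inj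
  /enum_rank_inj.
Qed.

(** The K0-plane of linear forms on the conic, multiplied by [nu]: the sections of the line bundle
    of degree 1. *)
Let in_H z := exists al be, [/\ K al, K be & z = nu * (al + be * fc)].

Let H_comb f : in_H (sec f).
Proof.
have [pf|/negbTE pf] := boolP (pairing f); last first.
  exists 0, 0; rewrite /sec pf mul0r addr0 mulr0; split=> //;
    exact: subfield0 hK.
have : exists2 a, a \in S & forall p, f p != a.
  have [/injectiveP f_inj /forallP fS] := andP pf.
  have : (0 < #|S :\: f @: [set: 'I_m * bool]|)%N.
    rewrite cardsD (setIidPr _); last by apply/subsetP => _ /imsetP[p _ ->].
    by rewrite card_imset // cardsT card_prod card_ord card_bool muln2 S_card
      subSnn.
  case/card_gt0P => a; rewrite inE => /andP[aN aS]; exists a => // p.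
  by apply: contraNneq aN => <-; apply: imset_f.
case=> a aS fa; have [ka [Kka _ ->]] := sec_missing pf aS fa.
exists (ka * frame_p y r0 r1 r2 a), (ka * frame_q M r0 a); split.
- by apply: (subfieldM hK) => //; apply: frame_p_mem.
- by apply: (subfieldM hK) => //; apply: frame_q_mem.
by rewrite /frame_l; ring.
Qed.

Let H_sum (v : T -> L) : in_H (\sum_f c (v f) * sec f).
Proof.
elim/big_rec: _ => [|f x _ [al [be [hal hbe ->]]]].
  by exists 0, 0; rewrite mul0r addr0 mulr0; split=> //; apply: subfield0 hK.
have [al' [be' [hal' hbe' ->]]] := H_comb f.
exists (c (v f) * al' + al), (c (v f) * be' + be); split; try ring;
  by apply: (subfieldD hK) => //; apply: (subfieldM hK) => //;
    apply: cross_field_const.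
Qed.

(** If all ratios of invariant sections were in K0, so would be, by Speiser's lemma, all ratios of
    sections. But pairings missing two distinct points a and b of S have sections with ratio
    [fl a / fl b] up to a factor in K0, which [frame_l_ratio] excludes. *)
Lemma conic_parameter : exists u al be ga de,
  [/\ forall g, tau g u = u, ~ K u,
      [/\ K al, K be, K ga & K de] & u = (al + be * fc) / (ga + de * fc)].
Proof.
have actT_mul : gal_action actT.
  by move=> g h gh ghE f; apply/ffunP => p; rewrite !ffunE (act_mul ghE).
have actT_cont : continuous_action actT.
  have [s hs] := act_cont; exists s => g gs f; apply/ffunP => p.
  by rewrite ffunE hs.
have sp := speiser hL tau_c actT_mul actT_cont tau_sec.
pose Inv := invariant_comb c tau sec.
suff [w [w' [[fw [v wE]] [fw' [v' w'E]] w'0 ww']]] :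
    exists w w', [/\ Inv w, Inv w', w' != 0 & ~ K (w / w')].
  have [al [be [hal hbe E]]] := H_sum v; have [ga [de [hga hde E']]] :=
    H_sum v'.
  exists (w / w'), al, be, ga, de; split=> //.
    by move=> g; rewrite fmorph_div fw fw'.
  by rewrite wE w'E E E' -mulf_div divff // mul1r.
apply: contrapT => Nex.
have ratioK w w' : Inv w -> Inv w' -> w' != 0 -> K (w / w').
  by move=> hw hw' w'0; apply: contrapT => N; apply: Nex; exists w, w'.
have [a aS [b bS ab]] : exists2 a, a \in S & exists2 b, b \in S & a != b.
  have : (1 < #|S|)%N by rewrite S_card ltnS double_gt0.
  by case/card_gt1P => a [b [aS bS ab]]; exists a => //; exists b.
have [f pf fa] := missing_ex aS; have [f' pf' fb] := missing_ex bS.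
have [ka [Kka ka0 sE]] := sec_missing pf aS fa.
have [kb [Kkb kb0 sE']] := sec_missing pf' bS fb.
have s0 : sec f' != 0 by rewrite sE' mulf_neq0 ?fl0 // (mulf_neq0 kb0 nu0).
have [w' hw' w'0] : exists2 w', Inv w' & w' != 0.
  apply: contrapT => N; move/eqP: s0; apply.
  have [ms hms] := sp f'; apply: (comb_min (W := fun x => x = 0)) => // al w x
    _ hw ->.
  have [->|w0] := eqVneq w 0; first by rewrite mulr0 addr0.
  by case: N; exists w => //; apply: hms.
have Ks h : K (sec h / w').
  have [ms hms] := sp h; apply: (comb_min (W := fun x => K (x / w'))).
    by rewrite mul0r; apply: subfield0 hK.
  move=> _ w x [al ->] hw hx; rewrite mulrDl; apply: (subfieldD hK) => //.
  rewrite -mulrA; apply: (subfieldM hK); first exact: cross_field_const.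
  by apply: ratioK => //; apply: hms.
apply: (frame_l_ratio (c := c) y_inj r01 r02 r12 c_notin ab).
have -> : fl a / fl b = (sec f / w') / (sec f' / w') * (kb / ka).
  by rewrite sE sE'; field; rewrite w'0 fl0 nu0 ka0 kb0.
by apply: (subfieldM hK); apply: (subfield_div hK).
Qed.

(** Both fields are K0(c). The Moebius relation can be solved for c because u is not in K0; and
    [frame_diff] expresses ratios of differences through K0 and c, the factors mu cancelling. *)
Lemma parameter_generates u al be ga de :
  ~ K u -> [/\ K al, K be, K ga & K de] -> u =
    (al + be * fc) / (ga + de * fc) ->
  forall z, diff_field c y z <-> poly_frac K u z.
Proof.
move=> uK [hal hbe hga hde] uE z.
have hP := poly_frac_subfield u hK.
(* A zero denominator would make u = 0, by the convention on inverses, and 0 is in K0. *)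
have den0 : ga + de * fc != 0.
  by apply/eqP => E; apply: uK; rewrite uE E invr0 mulr0; apply: subfield0 hK.
split.
  have hc : poly_frac K u fc.
    have [E|E] := eqVneq (be - de * u) 0; last first.
      have -> : fc = (ga * u - al) / (be - de * u).
        apply: (mulIf E); rewrite divfK //.
        have : u * (ga + de * fc) = al + be * fc by rewrite uE divfK.
        move=> /eqP; rewrite -subr_eq0 => /eqP U.
        by apply/eqP; rewrite -subr_eq0 -oppr_eq0 -U; apply/eqP; ring.
      apply: (subfield_div hP); apply: (subfieldB hP);
        try (apply: (subfieldM hP); last exact: poly_frac_gen);
        exact: poly_frac_const.
    case: uK; have [de0|de0] := eqVneq de 0; last first.
      have -> : u = be / de.
        by apply: (mulIf de0); rewrite divfK // mulrC; apply/esym/eqP;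
          rewrite -subr_eq0 E.
      exact: subfield_div.
    move: E; rewrite de0 mul0r subr0 => be0.
    by rewrite uE be0 de0 !mul0r !addr0; apply: subfield_div.
  apply: frac_of_min => //.
    by move=> a; apply: poly_frac_const => //; apply: cross_field_const.
  have hl i : poly_frac K u (fl i).
    apply: (subfieldD hP); first by apply: poly_frac_const => //;
      apply: frame_p_mem.
    by apply: (subfieldM hP) => //; apply: poly_frac_const => //;
      apply: frame_q_mem.
  have hdet i j : poly_frac K u (frame_det y r0 r1 r2 i j).
    by apply: poly_frac_const => //; apply: frame_det_mem.
  move=> _ [i [j [k [l ->]]]]; rewrite !(frame_diff y_inj r01 r02 r12).
  set mu := frame_mu _ _ _ _; have mu0 : mu != 0 by apply: frame_mu_neq0.
  have cancel A B C D : mu * A / B / (mu * C / D) = A / B / (C / D).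
    by rewrite -[mu * A / B]mulrA -[mu * C / D]mulrA invfM mulrACA divff //
      mul1r.
  by rewrite cancel; do !apply: (subfield_div hP) => //; apply: (subfieldM hP).
have hc : diff_field c y fc := frame_c_mem c y r0 r1 r2.
have hKD x : K x -> diff_field c y x := @cross_field_sub _ _ c n y x.
apply: poly_frac_min => //; rewrite uE.
by apply: (subfield_div hD); apply: (subfieldD hD);
  try apply: (subfieldM hD) => //; apply: hKD.
Qed.

End OddSubset.

(** * Transcendence over the field of cross-ratios *)

Section Places.
Variables (M K : fieldType).

(* The graph of a ring morphism to K from a local subring of M. *)
Definition place (E : M -> K -> Prop) :=
  [/\ forall z v v', E z v -> E z v' -> v = v', E 1 1,
      forall z v z' v', E z v -> E z' v' -> E (z - z') (v - v'),
      forall z v z' v', E z v -> E z' v' -> E (z * z') (v * v')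
    & forall z v, v != 0 -> E z v -> E z^-1 v^-1].

Variable E : M -> K -> Prop.
Hypothesis hE : place E.

Lemma place_uniq z v v' : E z v -> E z v' -> v = v'.
Proof. by case: hE => + _ _ _ _; apply. Qed.
Lemma place1 : E 1 1. Proof. by case: hE. Qed.
Lemma placeB z v z' v' : E z v -> E z' v' -> E (z - z') (v - v').
Proof. by case: hE => _ _ + _ _; apply. Qed.
Lemma placeM z v z' v' : E z v -> E z' v' -> E (z * z') (v * v').
Proof. by case: hE => _ _ _ + _; apply. Qed.
Lemma placeV z v : v != 0 -> E z v -> E z^-1 v^-1.
Proof. by case: hE => _ _ _ _; apply. Qed.
Lemma place0 : E 0 0.
Proof. by have := placeB place1 place1; rewrite !subrr. Qed.
Lemma placeN z v : E z v -> E (- z) (- v).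
Proof. by move=> hz; rewrite -sub0r -(sub0r v); apply: placeB place0 hz. Qed.
Lemma placeD z v z' v' : E z v -> E z' v' -> E (z + z') (v + v').
Proof.
by move=> hz hz'; rewrite -[z']opprK -[v']opprK; apply: placeB hz (placeN hz').
Qed.
Lemma place_div z v z' v' : v' != 0 -> E z v -> E z' v' -> E (z / z') (v / v').
Proof. by move=> v0 hz hz'; apply: placeM hz (placeV v0 hz'). Qed.
Lemma placeX z v i : E z v -> E (z ^+ i) (v ^+ i).
Proof.
move=> hz; elim: i => [|i IHi]; first exact: place1.
by rewrite !exprS; apply: placeM.
Qed.

Lemma place_mmap (k : fieldType) (n : nat) (c : {rmorphism k -> M})
    (c' : {rmorphism k -> K}) (y : 'I_n -> M) (y' : 'I_n -> K) p :
  (forall a, E (c a) (c' a)) -> (forall i, E (y i) (y' i)) ->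
  E (mmap c y p) (mmap c' y' p).
Proof.
move=> hc hy; rewrite /mmap.
elim/big_ind2: _ => [|z v z' v'|m _]; [exact: place0 | exact: placeD |].
apply: placeM => //; rewrite /mmap1.
elim/big_ind2: _ => [|z v z' v'|i _]; [exact: place1 | exact: placeM |].
exact: placeX.
Qed.

End Places.

Lemma place_fixed_subfield (M : fieldType) (E : M -> M -> Prop) :
  place E -> subfield (fun z => E z z).
Proof.
move=> hE; split; first exact: place1.
- by move=> x y; apply: placeB.
- by move=> x y; apply: placeM.
move=> x hx; have [->|x0] := eqVneq x 0; first by rewrite invr0; apply: place0.
exact: placeV.
Qed.

Lemma place_horner (M : fieldType) (E : M -> M -> Prop) (p : {poly M}) u v :
  place E -> (forall i, E p`_i p`_i) -> E u v -> E p.[u] p.[v].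
Proof.
move=> hE hp hu; rewrite !horner_coef.
elim/big_ind2: _ => [|z w z' w'|i _]; [exact: place0 | exact: placeD |].
by apply: placeM => //; apply: placeX.
Qed.

Section PartialEvaluation.
Variables (R : idomainType) (K : fieldType) (phi : {rmorphism R -> K}).

(** [phi] may have a kernel, so it is extended only to the local ring of that prime ideal. *)
Definition eval_frac (z : {fraction R}) (v : K) :=
  exists a b, [/\ phi b != 0, z = a%:F / b%:F & v = phi a / phi b].

Let nz b : phi b != 0 -> b%:F != 0 :> {fraction R}.
Proof.
by move=> pb; rewrite tofrac_eq0; apply: contraNneq pb => ->; rewrite rmorph0.
Qed.

Lemma eval_frac_tofrac a : eval_frac a%:F (phi a).
Proof. by exists a, 1; rewrite !rmorph1 !divr1 oner_neq0. Qed.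

Lemma eval_frac_place : place eval_frac.
Proof.
split.
- move=> _ v v' [a [b [pb -> ->]]] [a' [b' [pb' /eqP + ->]]].
  rewrite eqr_div ?nz // -!rmorphM tofrac_eq => /eqP E.
  by apply/eqP; rewrite eqr_div // -!rmorphM /= E.
- by have := eval_frac_tofrac 1; rewrite !rmorph1.
- move=> _ _ _ _ [a [b [pb -> ->]]] [a' [b' [pb' -> ->]]].
  exists (a * b' - a' * b), (b * b').
  by rewrite !rmorphB !rmorphM mulf_neq0 // -!mulNr !addf_div ?nz // !mulNr.
- move=> _ _ _ _ [a [b [pb -> ->]]] [a' [b' [pb' -> ->]]].
  by exists (a * a'), (b * b'); rewrite !rmorphM mulf_neq0 // !mulf_div.
move=> z v v0 [a [b [pb -> vE]]]; exists b, a; rewrite vE !invf_div; split=> //.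
by apply: contraNneq v0 => pa; rewrite vE pa mul0r.
Qed.

End PartialEvaluation.

Section FieldIdentities.
Variable M : fieldType.
Implicit Types a b c d z : M.

Lemma inversion_sub a b z : a - z != 0 -> b - z != 0 ->
  (a - z)^-1 - (b - z)^-1 = (b - a) / ((a - z) * (b - z)).
Proof. by move=> az bz; field; rewrite az bz. Qed.

Lemma inversion_cross_ratio a b c d z :
  a - z != 0 -> b - z != 0 -> c - z != 0 -> d - z != 0 ->
  a - d != 0 -> b - c != 0 ->
  (a - c) * (b - d) / ((a - d) * (b - c)) =
  ((c - a) / ((a - z) * (c - z)) * ((d - b) / ((b - z) * (d - z)))) /
  ((d - a) / ((a - z) * (d - z)) * ((c - b) / ((b - z) * (c - z)))).
Proof.
move=> az bz cz dz ad bc; rewrite -[d - a]opprB -[c - b]opprB.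
by field; rewrite !oppr_eq0 az bz cz dz ad bc.
Qed.

Lemma inversion_ratio a b c z : a - z != 0 -> b - z != 0 -> c - z != 0 ->
  c - b != 0 ->
  (a - c) / (c - b) * ((b - z) / (a - z)) =
  ((c - a) / ((a - z) * (c - z))) / ((b - c) / ((c - z) * (b - z))).
Proof.
move=> az bz cz cb; rewrite -[b - c]opprB.
by field; rewrite oppr_eq0 az bz cz cb.
Qed.

Lemma mobius_inj al be ga de a b :
  al * de - be * ga != 0 -> ga + de * a != 0 -> ga + de * b != 0 ->
  (al + be * a) / (ga + de * a) = (al + be * b) / (ga + de * b) -> a = b.
Proof.
move=> D0 ha hb /eqP; rewrite eqr_div // => /eqP E.
have : (al * de - be * ga) * (b - a) = 0.
  by move/eqP: E; rewrite -subr_eq0 => /eqP E; rewrite -[RHS]E; ring.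
by move/eqP; rewrite mulf_eq0 (negPf D0) /= subr_eq0 => /eqP.
Qed.

(** With zero determinant the transformation is constant, of value be / de or al / ga where its
    denominator is nonzero. *)
Lemma mobius_degenerate (Q : M -> Prop) al be ga de a : subfield Q ->
  Q al -> Q be -> Q ga -> Q de -> al * de - be * ga = 0 ->
  Q ((al + be * a) / (ga + de * a)).
Proof.
move=> hQ hal hbe hga hde D.
have [den0|den0] := eqVneq (ga + de * a) 0.
  by rewrite den0 invr0 mulr0; apply: subfield0 hQ.
have [de0|de0] := eqVneq de 0.
  move: D den0; rewrite de0 mulr0 sub0r mul0r addr0 => /eqP;
    rewrite oppr_eq0 mulf_eq0.
  case/orP=> /eqP ->; last by rewrite eqxx.
  by rewrite mul0r addr0 => _; apply: subfield_div.
have -> : (al + be * a) / (ga + de * a) = be / de; last exact: subfield_div.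
by apply/eqP; rewrite eqr_div // -subr_eq0; apply/eqP; rewrite -[RHS]D; ring.
Qed.

End FieldIdentities.

Section Transcendence.
Variables (L M : fieldType) (c : {rmorphism L -> M}) (n : nat) (y : 'I_n -> M).
Hypothesis y_inj : injective y.
Local Notation K := (cross_field c y).

Let yneq i j : i != j -> y i - y j != 0.
Proof. by rewrite subr_eq0 (inj_eq y_inj). Qed.

(* The place extending the projective transformation y i |-> 1 / (y i - z) fixes
   all cross-ratios. *)
Definition inversion_place (z : M) (E : M -> M -> Prop) :=
  [/\ place E, forall a, E (c a) (c a) & forall i, E (y i) (y i - z)^-1].

Section Inversion.
Variables (z : M) (E : M -> M -> Prop).
Hypotheses (z_y : forall i, y i != z) (hE : inversion_place z E).

Let zneq i : y i - z != 0. Proof. by rewrite subr_eq0. Qed.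
Let pE : place E. Proof. by case: hE. Qed.

Let idiff i j : E (y i - y j) ((y j - y i) / ((y i - z) * (y j - z))).
Proof.
rewrite -inversion_sub ?zneq //; apply: (placeB pE);
  apply: (let: And3 _ _ h := hE in h).
Qed.

Lemma inversion_cross_field x : K x -> E x x.
Proof.
apply: (frac_of_min (place_fixed_subfield pE)); first by case: hE.
move=> _ [i [j [k [l [u ->]]]]].
move: u; rewrite /= !inE !negb_or => /and4P[/and3P[ij ik il] /andP[jk jl] kl _].
rewrite {2}/cross (inversion_cross_ratio (z := z)) ?zneq ?yneq //.
apply: (place_div pE); last 2 first.
- by apply: (placeM pE); apply: idiff.
- by apply: (placeM pE); apply: idiff.
by rewrite !mulf_neq0 ?invr_eq0 ?mulf_neq0 ?yneq ?zneq // eq_sym.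
Qed.

(** Unlike a cross-ratio of the y i, c involves the point at infinity, which the inversion moves;
    hence the extra factor. *)
Lemma inversion_frame r0 r1 r2 : r0 != r1 -> r1 != r2 ->
  E (frame_c y r0 r1 r2)
    (frame_c y r0 r1 r2 * ((y r1 - z) / (y r0 - z))).
Proof.
move=> r01 r12; rewrite {2}/frame_c inversion_ratio ?zneq ?yneq // 1?eq_sym //.
apply: (place_div pE); try exact: idiff.
by rewrite !mulf_neq0 ?invr_eq0 ?mulf_neq0 ?yneq ?zneq // eq_sym.
Qed.

End Inversion.

Variables r0 r1 r2 : 'I_n.
Hypotheses (r01 : r0 != r1) (r02 : r0 != r2) (r12 : r1 != r2).
Local Notation fc := (frame_c y r0 r1 r2).

Variable pole : nat -> M.
Hypotheses (pole_inj : injective pole) (pole_y : forall k i, y i != pole k).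
Hypothesis pole_place : forall k, exists E, inversion_place (pole k) E.

Let fc_at i : M := fc * ((y r1 - pole i) / (y r0 - pole i)).

Let pole_neq i j : y j - pole i != 0. Proof. by rewrite subr_eq0. Qed.

Let fc_at_inj : injective fc_at.
Proof.
move=> i j /(mulfI (frame_c_neq0 y_inj r02 r12)) E; apply: pole_inj.
have D0 : y r1 * -1 - -1 * y r0 != 0.
  by rewrite mulrN1 mulN1r opprK addrC yneq.
have den k : y r0 + -1 * pole k != 0 by rewrite mulN1r.
by apply: (mobius_inj D0 (den i) (den j)); rewrite !mulN1r.
Qed.

(** An inversion place fixes K0 but multiplies c by (y r1 - z) / (y r0 - z), which differs from
    1. *)
Lemma frame_c_notin : ~ K fc.
Proof.
move=> hfc; have [E hE] := pole_place 0; have [pE _ _] := hE.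
have h1 := inversion_cross_field (pole_y 0) hE hfc.
have h2 := inversion_frame (pole_y 0) hE r01 r12.
have /eqP := place_uniq pE h1 h2; rewrite -[X in X == _]mulr1.
rewrite (inj_eq (mulfI (frame_c_neq0 y_inj r02 r12))) eq_sym.
rewrite -subr_eq0 -[X in _ - X](divff (pole_neq 0 r0)) -mulrBl mulf_eq0
  invr_eq0.
rewrite (negPf (pole_neq 0 r0)) orbF opprB addrA subrK.
by rewrite (negPf (yneq _)) // eq_sym.
Qed.

(* Under the inversions u takes infinitely many values, all of them roots of p. *)
Lemma cross_field_transcendental u al be ga de (p : {poly M}) :
  ~ K u -> [/\ K al, K be, K ga & K de] -> u =
    (al + be * fc) / (ga + de * fc) ->
  (forall i, K p`_i) -> p.[u] = 0 -> p = 0.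
Proof.
move=> uK [hal hbe hga hde] uE hp pu.
have hK := cross_field_subfield c y.
have det0 : al * de - be * ga != 0.
  by apply/eqP => D; apply: uK; rewrite uE; apply: mobius_degenerate.
pose den i := ga + de * fc_at i.
(* The denominator is a nonzero affine function of [fc_at i], and [fc_at] is injective: at most one
   index is bad, and the values are taken after it. *)
have [i0 hi0] : exists i0, forall i, (i0 <= i)%N -> den i != 0.
  have [[j /eqP dj]|N] := pselect (exists j, den j == 0); last first.
    by exists 0%N => i _; apply/negP => di; apply: N; exists i.
  exists j.+1 => i ij; apply/eqP => di.
  have de0 : de != 0.
    apply: contraNneq det0 => de0; move: dj; rewrite /den de0 mul0r addr0 => ->.
    by rewrite !mulr0 subrr.
  have : fc_at i = fc_at j by apply: (mulfI de0); apply: (addrI ga);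
    rewrite -/(den i) di -dj.
  by move/fc_at_inj => E; rewrite E ltnn in ij.
pose u_at i := (al + be * fc_at (i0 + i)) / den (i0 + i)%N.
have den_at i : den (i0 + i)%N != 0 by apply: hi0; apply: leq_addr.
have root_at i : root p (u_at i).
  have [E hE] := pole_place (i0 + i); have [pE _ _] := hE.
  have EK := inversion_cross_field (pole_y (i0 + i)) hE.
  have Efc : E fc (fc_at (i0 + i)) :=
    inversion_frame (pole_y (i0 + i)) hE r01 r12.
  have Eu : E u (u_at i).
    by rewrite uE; apply: (place_div pE (den_at i)); apply: (placeD pE);
       try apply: (placeM pE) => //; apply: EK.
  have := place_horner pE (fun j => EK _ (hp j)) Eu; rewrite pu => h.
  by apply/rootP; rewrite (place_uniq pE h (place0 pE)).
have u_at_inj : injective u_at.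
  by move=> i j /(mobius_inj det0 (den_at i) (den_at j)) /fc_at_inj /addnI.
apply/eqP; apply: contraT => p0.
have := max_poly_roots p0 (rs := [seq u_at i | i <- iota 0 (size p)]).
rewrite size_map size_iota ltnn map_inj_uniq // iota_uniq; apply=> //.
by apply/allP => _ /mapP[i _ ->].
Qed.

End Transcendence.

Section GenericPoints.
Variables (L : fieldType) (n : nat).
Local Notation M := {fraction {mpoly L[n]}}.
Local Notation c := (frac_mpolyC n L).
Local Notation y := (@pt L n).

Lemma pt_indep (p : {mpoly L[n]}) : mmap c y p = 0 -> p = 0.
Proof.
have -> : mmap c y p = p%:F by rewrite (mmap_unique
  (@FracField.tofrac {mpoly L[n]})).
by move/eqP; rewrite tofrac_eq0 => /eqP.
Qed.

Lemma pt_inj : injective y. Proof. exact: indep_inj pt_indep. Qed.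

(** The coordinates are substituted in the source only; z belongs to the target and may itself be
    any function of them. *)
Lemma pt_inversion_place (z : M) : exists E, inversion_place c y z E.
Proof.
pose phi : {rmorphism {mpoly L[n]} -> M} := mmap c (fun i => (y i - z)^-1).
exists (eval_frac phi); split; first exact: eval_frac_place.
  by move=> a; have := eval_frac_tofrac phi a%:MP; rewrite {2}/phi /= mmapC;
    apply.
by move=> i; have := eval_frac_tofrac phi 'X_i; rewrite {2}/phi /=
  mmapX mmap1U; apply.
Qed.

Variable r0 : 'I_n.
(** Powers of a coordinate give infinitely many poles over every L, finite or not. The exponents
    start at 2 to avoid the point [y r0] itself. *)
Definition pt_pole k : M := ('X_[U_(r0) *+ k.+2])%:F.

Lemma pt_pole_neq k i : y i != pt_pole k.
Proof.
rewrite tofrac_eq; apply/eqP => /mpolyP/(_ U_(i)%MM).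
rewrite !mcoeffX eqxx; case: eqP => [/(congr1 mdeg)|_ /eqP];
  last by rewrite oner_eq0.
by rewrite mdegMn !mdeg1 mul1n.
Qed.

Lemma pt_pole_inj : injective pt_pole.
Proof.
move=> i j /eqP; rewrite tofrac_eq => /eqP/mpolyP/(_ (U_(r0) *+ j.+2)%MM).
rewrite !mcoeffX eqxx; case: eqP => [/(congr1 mdeg)|_ /eqP];
  last by rewrite eq_sym oner_eq0.
by rewrite !mdegMn !mdeg1 !mul1n => -[].
Qed.

End GenericPoints.

(** * Function fields of products *)

Lemma birational_trans (k : fieldType) (X Y Z : variety k) :
  birational X Y -> birational Y Z -> birational X Z.
Proof.
move=> [f [fc fD fM fI [fF fS]]] [g [gc gD gM gI [gF gS]]].
exists (g \o f); split => [a|x y hx hy|x y hx hy|x y hx hy /=|].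
- by rewrite /= fc gc.
- by rewrite /= fD // gD //; apply: fF.
- by rewrite /= fM // gM //; apply: fF.
- by move/gI => E; apply: fI => //; apply: E; apply: fF.
split=> [x hx|z hz]; first exact/gF/fF.
by have [y hy <-] := gS z hz; have [x hx <-] := fS y hy; exists x.
Qed.

(* The generic point of X supplies the local ring O. *)
Lemma P1_times_funfield (k : fieldType) (X : variety k) :
  subfield (@funfield k X) -> (forall a, funfield (@Defs.scalar k X a)) ->
  (forall O, @stalk k X O -> forall z, O z -> funfield z) ->
  (exists2 O, @stalk k X O & forall z, funfield z -> O z) ->
  forall z, @funfield k (P1_times X) z <-> exists A B : {poly ambient X},
    [/\ forall i, funfield A`_i, forall i, funfield B`_i, B != 0 & z =
      A%:F / B%:F].
Proof.
set K := @funfield k X.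
move=> hK hC hO [O sO KO] z.
pose Q z := exists A B : {poly ambient X},
    [/\ forall i, K A`_i, forall i, K B`_i, B != 0 & z = A%:F / B%:F].
have coefC a : K a -> forall i, K (a%:P)`_i := @subfield_coefC _ _ hK a.
have coef1 i : K (1 : {poly ambient X})`_i.
  by apply: coefC; exact: (subfield1 hK).
have coefX := subfield_coefX hK; have coefM := subfield_coefM hK.
have Q_poly (A : {poly ambient X}) : (forall i, K A`_i) -> Q A%:F.
  by move=> hA; exists A, 1; rewrite oner_neq0 rmorph1 divr1.
have F0 (A : {poly ambient X}) : (A%:F == 0) = (A == 0) by rewrite tofrac_eq0.
have hQ : subfield Q.
  split; first by rewrite -(rmorph1 (@FracField.tofrac _)); apply: Q_poly.
  - move=> _ _ [A [B [hA hB B0 ->]]] [A' [B' [hA' hB' B'0 ->]]].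
    exists (A * B' - A' * B), (B * B'); split;
      [|exact: coefM|by rewrite mulf_neq0|].
      by move=> i; rewrite coefB; apply: (subfieldB hK); apply: coefM.
    by rewrite !rmorphB !rmorphM -!mulNr addf_div ?F0 // !mulNr.
  - move=> _ _ [A [B [hA hB B0 ->]]] [A' [B' [hA' hB' B'0 ->]]].
    exists (A * A'), (B * B'); split; try exact: coefM;
      first by rewrite mulf_neq0.
    by rewrite !rmorphM mulf_div.
  move=> _ [A [B [hA hB B0 ->]]]; have [->|A0] := eqVneq A 0.
    rewrite rmorph0 mul0r invr0 -(rmorph0 (@FracField.tofrac _)).
    by apply: Q_poly => i; rewrite coef0; exact: (subfield0 hK).
  by exists B, A; rewrite invf_div; split.
split.
  case=> -[[O' sO'] b]; apply: (frac_of_min hQ) => [a|x] /=.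
    by apply: Q_poly; apply: coefC; apply: hC.
  case=> [[a Oa ->]|->].
    by apply: Q_poly; apply: coefC; apply: (hO O').
  case: b; last apply: (subfieldV hQ); exact: Q_poly.
case=> A [B [hA hB B0 ->]]; exists (exist _ O sO, true).
set c := (X in gen_alg X); set S := (X in gen_alg c X).
have gen_poly (P : {poly ambient X}) : (forall i, K P`_i) -> gen_alg c S P%:F.
  move=> hP; have -> : P = \sum_(i < size P) (P`_i)%:P * 'X^i.
    by rewrite -[LHS]coefK poly_def; apply: eq_bigr => i _; rewrite mul_polyC.
  rewrite rmorph_sum; elim/big_rec: _ => [|i x _ hx]; first exact: gen_alg0.
  apply: gen_add => //; rewrite rmorphM; apply: gen_mul.
    apply: gen_in; left; exists P`_i => //; apply: KO; exact: hP.
  rewrite rmorphXn; elim: (i : nat) => [|j hj]; first by rewrite expr0;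
    apply: gen_alg1.
  by rewrite exprS; apply: gen_mul => //; apply: gen_in; right.
by exists A%:F, B%:F; split; rewrite ?F0 //; apply: gen_poly.
Qed.

(** Birational equivalence sees only the function field, so a variety without local rings can serve
    as the intermediate term between projective space and the product. *)
Definition generic_variety (k M : fieldType) (c : {rmorphism k -> M})
    (K : M -> Prop) : variety k :=
  @Variety k M c K (fun=> False).

(** The map A(u)/B(u) -> A(t)/B(t) is well defined and injective because no nonzero polynomial over
    the function field vanishes at u. *)
Lemma P1_times_birational (k : fieldType) (X : variety k) (u : ambient X) :
  subfield (@funfield k X) -> (forall a, funfield (@Defs.scalar k X a)) ->
  (forall O, @stalk k X O -> forall z, O z -> funfield z) ->
  (exists2 O, @stalk k X O & forall z, funfield z -> O z) ->
  (forall p : {poly ambient X}, (forall i, funfield p`_i) -> p.[u] = 0 -> p =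
    0) ->
  birational (generic_variety (@Defs.scalar k X) (poly_frac (@funfield k X) u))
    (P1_times X).
Proof.
set K := @funfield k X.
move=> hK hC hO hgen u_tr; have funE := P1_times_funfield hK hC hO hgen.
pose Rel (z : ambient X) (v : {fraction {poly ambient X}}) :=
  exists A B : {poly ambient X},
  [/\ forall i, K A`_i, forall i, K B`_i, B != 0, z = A.[u] / B.[u] & v =
    A%:F / B%:F].
have nz (B : {poly ambient X}) : (forall i, K B`_i) -> B != 0 -> B.[u] != 0.
  by move=> hB; apply: contraNneq => /(u_tr B hB) ->.
have coefM := subfield_coefM hK.
have F0 (A : {poly ambient X}) : (A%:F == 0) = (A == 0) by rewrite tofrac_eq0.
have cross_mul z v z' v' : Rel z v -> Rel z' v' -> (z = z' <-> v = v').
  move=> [A [B [hA hB B0 -> ->]]] [A' [B' [hA' hB' B'0 -> ->]]].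
  have B1 := nz B hB B0; have B'1 := nz B' hB' B'0.
  split=> /eqP; rewrite eqr_div ?F0 //.
    move=> /eqP E; apply/eqP; rewrite eqr_div ?F0 // -!rmorphM tofrac_eq
      -subr_eq0.
    apply/eqP/u_tr; last by rewrite hornerD hornerN !hornerM E subrr.
    by move=> i; rewrite coefB; apply: (subfieldB hK); apply: coefM.
  rewrite -!rmorphM tofrac_eq => /eqP E.
  by apply/eqP; rewrite eqr_div // -!hornerM E.
have Rel_ex z : poly_frac K u z -> exists v, Rel z v.
  move=> [A [B [hA hB B0 ->]]]; exists (A%:F / B%:F); exists A, B; split=> //.
  by apply: contraNneq B0 => ->; rewrite horner0.
pose f z := if pselect (exists v, Rel z v) is left h then sval (cid h) else 0.
have fRel z v : Rel z v -> f z = v.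
  rewrite /f => hz; case: pselect => [h|]; last by case; exists v.
  by case: cid => /= v' hz'; apply/(cross_mul _ _ _ _ hz' hz).
have RelD z v z' v' : Rel z v -> Rel z' v' -> Rel (z + z') (v + v').
  move=> [A [B [hA hB B0 -> ->]]] [A' [B' [hA' hB' B'0 -> ->]]].
  exists (A * B' + A' * B), (B * B'); split;
    [|exact: coefM|by rewrite mulf_neq0| |].
  - by move=> i; rewrite coefD; apply: (subfieldD hK); apply: coefM.
  - by rewrite hornerD !hornerM addf_div ?nz.
  by rewrite rmorphD !rmorphM addf_div ?F0.
have RelM z v z' v' : Rel z v -> Rel z' v' -> Rel (z * z') (v * v').
  move=> [A [B [hA hB B0 -> ->]]] [A' [B' [hA' hB' B'0 -> ->]]].
  exists (A * A'), (B * B'); split; try exact: coefM;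
    first by rewrite mulf_neq0.
    by rewrite !hornerM mulf_div.
  by rewrite !rmorphM mulf_div.
have fR z : poly_frac K u z -> Rel z (f z).
  by move=> /Rel_ex[v hz]; rewrite (fRel _ _ hz).
exists f; split=> [a|x y hx hy|x y hx hy|x y hx hy E|].
- apply: fRel; exists (@Defs.scalar k X a)%:P, 1.
  rewrite !hornerC rmorph1 !divr1 oner_neq0; split=> // i; rewrite coefC;
    case: ifP => _ //;
    by [apply: hC | apply: subfield0 hK | apply: subfield1 hK].
- exact/fRel/RelD/fR/hy/fR/hx.
- exact/fRel/RelM/fR/hy/fR/hx.
- by apply/(cross_mul _ _ _ _ (fR _ hx) (fR _ hy)).
split=> [x /fR[A [B [hA hB B0 _ ->]]]|v /funE[A [B [hA hB B0 ->]]]].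
  by apply/funE; exists A, B.
exists (A.[u] / B.[u]); first by exists A, B; split=> //; apply: nz.
by apply: fRel; exists A, B.
Qed.

(** * The twisted moduli space and its function field *)

Section TwistedMbar.
Variables (F L : fieldType) (iota : {rmorphism F -> L}) (n : nat).
Hypothesis hL : galois_extension iota.
Variable rho : Gal iota -> 'S_n.
Hypotheses (rho_hom : gal_hom rho) (rho_cont : gal_continuous rho).
Local Notation M := {fraction {mpoly L[n]}}.
Local Notation c := (frac_mpolyC n L).
Local Notation K := (cross_field c (@pt L n)).

Lemma twist_morphism : exists tau : Gal iota -> {rmorphism M -> M},
  forall g z, tau g z = twist_action rho g z.
Proof.
suff ex g : exists t : {rmorphism M -> M}, forall z, t z = twist_action rho g z.
  by exists (fun g => sval (cid (ex g))) => g z; case: cid.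
pose h : {rmorphism {mpoly L[n]} -> M} :=
  @FracField.tofrac {mpoly L[n]} \o twist_poly rho g.
have h_inj p : h p = 0 -> p = 0.
  move/eqP; rewrite /h /= tofrac_eq0 => /eqP E;
    apply: (@twist_poly_inj _ _ _ _ rho g).
  by rewrite rmorph0.
have [t tE] := fraction_eval h_inj; exists t => z.
have [a [b [b0 ->]]] := frac_surj z.
by rewrite fmorph_div !tE; apply/esym/twist_actionE.
Qed.

Definition rho_act g (i : 'I_n) := rho g i.

Lemma rho_action : gal_action rho_act.
Proof. by move=> g h gh ghE t; apply: rho_hom. Qed.

Lemma rho_continuous : continuous_action rho_act.
Proof.
have [e e1] := gal_one iota; have [s hs] := rho_cont e; exists s => g gs i.
rewrite /rho_act (hs g) => [|x xs]; last by rewrite gs ?e1.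
by apply: (@perm_inj _ (rho e)); rewrite -(rho_hom (gh := e)) // => x;
  rewrite !e1.
Qed.

Lemma Mbar_funfield z : @funfield L (Mbar L n) z <-> K z.
Proof.
split; last by exists (fun _ _ _ _ => true).
case=> e; apply: (frac_of_min (cross_field_subfield _ _)) => [a|x].
  exact: cross_field_const.
move=> [i [j [k [l [u ->]]]]]; have hx := cross_mem c (@pt L n) u.
by case: (e i j k l) => //; apply: (subfieldV (cross_field_subfield _ _)).
Qed.

Variable tau : Gal iota -> {rmorphism M -> M}.
Hypothesis tauE : forall g z, tau g z = twist_action rho g z.
Local Notation X := (twisted_Mbar rho).

Let tau_c g a : tau g (c a) = c (g a).
Proof. by rewrite tauE twist_action_scalar. Qed.

Let tau_pt g i : tau g (pt L i) = pt L (rho_act g i).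
Proof. by rewrite tauE twist_action_pt. Qed.

Lemma twisted_funfield : @funfield F X = fun z => K z /\ forall g, tau g z = z.
Proof.
apply/funext => z; apply/propext.
split=> -[hz fz]; (split; first by apply/Mbar_funfield); move=> g.
  by rewrite tauE; apply: fz.
by rewrite -tauE; apply: fz.
Qed.

Lemma twisted_stalk_sub O : @stalk F X O -> forall z, O z -> @funfield F X z.
Proof.
move=> [O' [e [P [[_ [P0 _] _ _ _] O'E]]] OE] z
  /OE[/O'E[a [b [ha hb Pb ->]]] fz].
split=> //; exists e, a, b; split=> //.
by apply: contra_notN Pb => /eqP ->.
Qed.

(** The prime ideal 0 of a chart gives the local ring of the generic point, which is the function
    field. *)
Lemma twisted_generic_stalk :
  exists2 O, @stalk F X O & forall z, @funfield F X z -> O z.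
Proof.
exists (@funfield F X) => //; exists (@funfield L (Mbar L n)) => //.
exists (fun _ _ _ _ => true), (fun z => z = 0); split.
  split=> //.
  - by move=> x ->; apply: gen_alg0.
  - by split=> // /eqP; rewrite oner_eq0.
  - by move=> x y -> ->; rewrite addr0.
  - by move=> a x _ ->; rewrite mulr0.
  by move=> a b _ _ /eqP; rewrite mulf_eq0 => /orP[] /eqP; [left | right].
move=> z; split.
  by move/Mbar_funfield => [a [b [ha hb /eqP b0 ->]]]; exists a, b.
by move=> [a [b [ha hb /eqP b0 ->]]]; apply/Mbar_funfield; exists a, b.
Qed.

(** Specializing y i0 to 0 and the k-th remaining coordinate to 1 / X_k sends [from_pole] k to X_k,
    so a relation becomes the same relation among variables. *)
Lemma from_pole_indep (i0 : 'I_n) (p : {mpoly L[n.-1]}) :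
  mmap c (from_pole (@pt L n) i0) p = 0 -> p = 0.
Proof.
pose M' := {fraction {mpoly L[n.-1]}}.
pose y' (i : 'I_n) : M' := if unlift i0 i is Some k then (pt L k)^-1 else 0.
pose phi : {rmorphism {mpoly L[n]} -> M'} := mmap (frac_mpolyC n.-1 L) y'.
have pE := eval_frac_place phi.
have pt0 k : pt L k != 0 :> M'.
  rewrite tofrac_eq0; apply/eqP => /mpolyP/(_ U_(k)%MM)/eqP.
  by rewrite mcoeffXU eqxx mcoeff0 oner_eq0.
have E_c a : eval_frac phi (c a) (frac_mpolyC n.-1 L a).
  by have := eval_frac_tofrac phi a%:MP; rewrite {2}/phi /= mmapC; apply.
have E_pt i : eval_frac phi (pt L i) (y' i).
  by have := eval_frac_tofrac phi 'X_i; rewrite {2}/phi /= mmapX mmap1U; apply.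
have E_pole k : eval_frac phi (from_pole (@pt L n) i0 k) (pt L k).
  have := placeB pE (E_pt (lift i0 k)) (E_pt i0).
  rewrite /y' liftK unlift_none subr0 => h.
  by rewrite -[pt L k]invrK; apply: (placeV pE); rewrite ?invr_eq0.
have := place_mmap pE p E_c E_pole => /[swap] ->.
by move/(place_uniq pE (place0 pE))/esym/pt_indep.
Qed.

Lemma twisted_Mbar_rational (i0 : 'I_n) : (4 <= n)%N ->
  (forall g, rho g i0 = i0) -> rational X.
Proof.
move=> hn fi0.
have lift_ex g k : exists k', rho g (lift i0 k) = lift i0 k'.
  case: (unliftP i0 (rho g (lift i0 k))) => [k' ->|E]; first by exists k'.
  by have := neq_lift i0 k; rewrite -(inj_eq (@perm_inj _ (rho g))) E fi0 eqxx.
pose act g k := sval (cid (lift_ex g k)).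
have actE g k : lift i0 (act g k) = rho_act g (lift i0 k).
  by rewrite /act /rho_act; case: cid => k' /= ->.
have act_mul : gal_action act.
  by move=> g h gh ghE k; apply: (@lift_inj _ i0);
    rewrite !actE (rho_action ghE).
have act_cont : continuous_action act.
  have [s hs] := rho_continuous; exists s => g gs k.
  by apply: (@lift_inj _ i0); rewrite actE hs.
pose y := from_pole (@pt L n) i0.
have tau_y g k : tau g (y k) = y (act g k).
  by rewrite /y /from_pole fmorphV rmorphB !tau_pt actE /rho_act fi0.
have i01 : @Ordinal n.-1 0 _ != @Ordinal n.-1 1 _ by [].
have [d [w [w_fix w_indep wE]]] := affine_quotient_rational hL tau_c act_mul
  act_cont tau_y
  (@from_pole_indep i0) (i01 ltac:(lia) ltac:(lia)).
exists d; apply: (@projective_space_birational F X d w) => // z.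
rewrite twisted_funfield -wE; split=> -[hz fz]; split=> //.
  exact/(diff_field_from_pole c (@pt_inj L n)).
exact/(diff_field_from_pole c (@pt_inj L n) i0).
Qed.

Lemma P1_twisted_Mbar_rational_ge3 (S : {set 'I_n}) (m : nat) :
  #|S| = m.*2.+1 -> (0 < m)%N -> (forall g i, i \in S -> rho g i \in S) ->
  rational (P1_times X).
Proof.
move=> S_card m0 S_stable.
have n3 : (2 < n)%N.
  by rewrite -[n]card_ord; apply: leq_trans (max_card (mem S)); rewrite S_card;
    lia.
pose r0 := Ordinal (ltnW (ltnW n3)); pose r1 := Ordinal (ltnW n3); pose r2 :=
  Ordinal n3.
have [r01 r02 r12] : [/\ r0 != r1, r0 != r2 & r1 != r2] by [].
have y_inj := @pt_inj L n.
have pole_place k := pt_inversion_place (pt_pole L r0 k).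
have c_notin : ~ K (frame_c (@pt L n) r0 r1 r2).
  exact (frame_c_notin y_inj r01 r02 r12 (@pt_pole_neq L n r0) pole_place).
have [u [al [be [ga [de [fu uK Ku uE]]]]]] :=
  conic_parameter hL tau_c rho_action
  rho_continuous tau_pt y_inj r01 r02 r12 c_notin S_card m0 S_stable.
have genE := parameter_generates y_inj r01 r02 r12 uK Ku uE.
have u_tr (p : {poly M}) : (forall i, K p`_i) -> p.[u] = 0 -> p = 0.
  exact: (cross_field_transcendental y_inj r01 r02 r12 (@pt_pole_inj L n r0)
    (@pt_pole_neq L n r0) pole_place uK Ku uE).
have hK := cross_field_subfield c (@pt L n).
have [d [w [w_fix w_indep wE]]] := affine_quotient_rational hL tau_c rho_action
  rho_continuous tau_pt (@pt_indep L n) r01.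
(* The invariants of K1, which are the field generated by u over the invariants of K0, link the two
   sides: the affine quotient of all n points compares them with projective space, the transcendence
   of u with the product. *)
exists d; apply: (@birational_trans _ _ (generic_variety (@Defs.scalar F X)
   (poly_frac (@funfield F X) u))).
  rewrite twisted_funfield.
  apply: (@projective_space_birational F (generic_variety (@Defs.scalar F X) _)
    d w) => // z.
  rewrite -wE -[funfield z]/(poly_frac _ u z) -descent_poly_frac //.
    by split=> -[hz fz]; split=> //; apply/genE.
  by move=> g a; apply: (cross_field_tau tau_c rho_action rho_continuous
    tau_pt).
apply: P1_times_birational.
- by rewrite twisted_funfield; apply: subfield_fixed.
- move=> a; rewrite twisted_funfield; split; first exact: cross_field_const.
  by move=> g; rewrite tau_c /= gal_fix.
- exact: twisted_stalk_sub.
- exact: twisted_generic_stalk.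
by move=> p hp; apply: u_tr => i; have := hp i; rewrite twisted_funfield => -[].
Qed.

(* If S has only one point, the whole set or the complement of S is used instead:
   two independent sections require two points. *)
Lemma P1_twisted_Mbar_rational (S : {set 'I_n}) : (4 <= n)%N -> odd #|S| ->
  (forall g i, i \in S -> rho g i \in S) -> rational (P1_times X).
Proof.
move=> hn S_odd S_stable.
have card_half k : odd k -> k = k./2.*2.+1 by move=> ok;
  rewrite -[LHS]odd_double_half ok.
have [S1|S3] := leqP #|S| 2; last first.
  apply: P1_twisted_Mbar_rational_ge3 (card_half _ S_odd) _ S_stable; lia.
have {S1} S1 : #|S| = 1%N by move: S_odd S1; case: #|S| => [|[|[|]]].
have [n_odd|n_even] := boolP (odd n).
  have nE : #|[set: 'I_n]| = n./2.*2.+1 by rewrite cardsT card_ord -card_half.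
  by apply: P1_twisted_Mbar_rational_ge3 nE _ _ => [|g i]; [lia | rewrite !inE].
have CE : #|~: S| = n.-1./2.*2.+1.
  by rewrite cardsCs setCK card_ord S1 subn1 -card_half //; lia.
apply: P1_twisted_Mbar_rational_ge3 CE _ _; first lia.
move=> g i; rewrite !inE; apply: contra => giS.
have [h [hg _]] := gal_inv g; have := S_stable h _ giS.
by rewrite -[rho h _]/(rho_act h (rho_act g i))
  (act_cancel rho_action rho_continuous hg).
Qed.

End TwistedMbar.

Theorem proposition4 (n : nat) (hn : (4 <= n)%N)
    (F L : fieldType) (iota : {rmorphism F -> L})
    (hL : galois_extension iota)
    (rho : Gal iota -> 'S_n)
    (rho_hom : gal_hom rho) (rho_cont : gal_continuous rho) :
  ((exists i : 'I_n, forall g : Gal iota, rho g i = i) ->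
     rational (twisted_Mbar rho))
  /\
  (odd n -> rational (P1_times (twisted_Mbar rho)))
  /\
  ((exists S : {set 'I_n}, odd #|S| /\
      forall (g : Gal iota) (i : 'I_n), i \in S -> rho g i \in S) ->
     rational (P1_times (twisted_Mbar rho))).
Proof.
have [tau tauE] := twist_morphism rho.
split; first by move=> [i fi]; apply: (twisted_Mbar_rational hL rho_hom
  rho_cont tauE hn fi).
have odd_case (S : {set 'I_n}) : odd #|S| ->
    (forall g i, i \in S -> rho g i \in S) ->
      rational (P1_times (twisted_Mbar rho)).
  exact: (P1_twisted_Mbar_rational hL rho_hom rho_cont tauE hn).
split=> [n_odd|[S [S_odd S_stable]]]; last exact: odd_case S_odd S_stable.
by apply: (odd_case [set: 'I_n]) => [|g i]; rewrite ?cardsT ?card_ord // !inE.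
Qed.
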